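(* It holds that $B_{k}^{m} \subsetneqq B_{k}$ for $k=3$, for $k=5$ and for every integer $k \geqslant 7$.
   Context: All graphs are finite and simple. A grid consists of horizontal grid lines (rows, increasing from bottom to top) and vertical grid lines (columns, increasing from left to right). A grid point is a crossing of two grid lines. A grid edge is the part of a grid line between two consecutive grid points. A path on a grid consists of two grid points (its end points) and a number of consecutive grid edges connecting them. A bend of a path is a turn of the path at a grid point. An EPG representation of a graph $G$ assigns to each vertex $v$ of $G$ a path $P_v$ on a common grid such that two distinct vertices $v,w$ are adjacent in $G$ if and only if $P_v$ and $P_w$ share at least one grid edge. A path is monotonic if it is ascending in both columns and rows, i.e. it has the shape of a staircase going upwards from left to right. For a nonnegative integer $k$, $B_k$ is the class of all graphs that have an EPG representation in which every path has at most $k$ bends, and $B_k^m$ (the superscript $m$ is just a symbol for ''monotonic'') is the class of all graphs that have an EPG representation in which every path is monotonic and has at most $k$ bends. *)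

(* Defs.v *)
From mathcomp Require Import all_boot.

Set Implicit Arguments.
Unset Strict Implicit.
Unset Printing Implicit Defensive.

Record sgraph := SGraph {
  vertex :> finType;
  adj : rel vertex;
  adj_sym : symmetric adj;
  adj_irrefl : irreflexive adj
}.

(* The point (x, y) is the crossing of column x (columns increase from left to
   right) and row y (rows increase from bottom to top).  The grid N x N is used
   as the common grid: a finite graph only uses a finite part of it. *)
Definition gpoint : Type := (nat * nat)%type.

Definition gadj (p q : gpoint) : bool :=
  ((p.2 == q.2) && ((q.1 == p.1.+1) || (p.1 == q.1.+1))) ||
  ((p.1 == q.1) && ((q.2 == p.2.+1) || (p.2 == q.2.+1))).

(* A path is given by the list of its grid points, from one end point to the
   other.  As usual for edge intersection graphs of paths on a grid, paths are
   simple and have at least one edge.  Both traversals of a path are allowed,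
   so the notions below do not depend on the direction of the list. *)
Definition gpath (s : seq gpoint) : bool :=
  [&& 1 < size s, sorted gadj s & uniq s].

Definition steps (T : Type) (s : seq T) : seq (T * T) := zip s (behead s).

Definition share_edge (s t : seq gpoint) : bool :=
  has (fun e => (e \in steps t) || ((e.2, e.1) \in steps t)) (steps s).

Definition horizontal (e : gpoint * gpoint) : bool := e.1.2 == e.2.2.

Definition bends (s : seq gpoint) : nat :=
  count (fun ef => horizontal ef.1 != horizontal ef.2) (steps (steps s)).

Definition ascending (s : seq gpoint) : bool :=
  sorted (fun p q : gpoint => (p.1 <= q.1) && (p.2 <= q.2)) s.

Definition monotonic (s : seq gpoint) : bool :=
  ascending s || ascending (rev s).

Definition epg_representation (G : sgraph) (P : G -> seq gpoint) : Prop :=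
  (forall v, gpath (P v)) /\
  (forall v w, v != w -> adj v w = share_edge (P v) (P w)).

Definition B (k : nat) (G : sgraph) : Prop :=
  exists P : G -> seq gpoint,
    epg_representation P /\ (forall v, bends (P v) <= k).

Definition Bm (k : nat) (G : sgraph) : Prop :=
  exists P : G -> seq gpoint,
    epg_representation P /\ (forall v, monotonic (P v) /\ bends (P v) <= k).

Definition proper_subclass (C D : sgraph -> Prop) : Prop :=
  (forall G, C G -> D G) /\ (exists G, D G /\ ~ C G).

(* Main.v *)
Require Import Defs.
From mathcomp Require Import all_boot zify.

Set Implicit Arguments.
Unset Strict Implicit.
Unset Printing Implicit Defensive.

(* Consider a family A of pairwise edge-disjoint paths and a larger family of
   pairwise edge-disjoint paths b, each of them sharing edges with m members of A.
   Between two consecutive ones, a and a', the path b usually bends twice; it can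
   save a bend only by running straight past an end of a segment of a or a', or by
   bending at a common point of a and a'.  Two edge-disjoint ascending paths with
   at most k bends have at most k + 1 common points, since both bend between any
   two of these, and two paths b can bend at each.  So, up to lower order terms,
   ascending representations allow 2(k + 1) savings for every pair of members of A
   met by a common b.

   Without monotonicity, two families of M paths can be arranged such that each
   path of the first crosses each of the second about (k/2 + 1)^2 times.  For
   k >= 4, k-bend staircases along the crossing points meet m = k + 1 members of A
   and save k bends each; for k = 3, paths with m = 3 that save one bend are
   attached to both sides of 5 crossings per pair.  For large M this is more than
   what ascending paths allow. *)

(** * Two counting inequalities *)

(** Every [i] counted on the left has a witness [j] satisfying [P], and no [j] serves two different
    [i]. *)
Lemma sum_exists_le (I J : finType) (P : pred J) (Q : I -> pred J) :
  (forall j, P j -> forall i i', Q i j -> Q i' j -> i = i') ->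
  \sum_i [exists j, P j && Q i j] <= \sum_j P j.
Proof.
move=> Quniq; apply: (@leq_trans (\sum_i \sum_j (P j && Q i j))).
  apply: leq_sum => i _; case: existsP => //= -[j PQ].
  by rewrite (bigD1 j) //= PQ.
rewrite exchange_big; apply: leq_sum => j _ /=.
case Pj: (P j) => /=; last by rewrite big1.
case: (pickP (Q^~ j)) => [i Qi|Q0]; last by rewrite big1 // => i _; rewrite Q0.
rewrite (bigD1 i) //= Qi big1 ?addn0 // => i' ni'; apply/eqP; rewrite eqb0.
by apply: contra_neqN ni' => Qi'; apply: Quniq Qi.
Qed.

(** The number of members of [D] below [t] increases strictly along [C], and below [N] it takes at
    most one value more than [D] has members there. *)
Lemma interlaced_count (N : nat) (C D : pred nat) :
  (forall t t', C t -> C t' -> t < t' -> exists2 d, D d & t < d < t') ->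
  \sum_(t < N) C t <= (\sum_(t < N) D t).+1.
Proof.
move=> CD; pose f (n : nat) := \sum_(0 <= t < n) D t.
have fD n d : D d -> d < n -> f d < f n.
  move=> Dd ltdn; rewrite /f (@big_cat_nat _ _ _ d.+1 0 n) //=.
  by rewrite big_nat_recr //= Dd; lia.
have f_le m n : m <= n -> f m <= f n.
  by move=> lemn; rewrite /f (@big_cat_nat _ _ _ m 0 n) //=; apply: leq_addr.
rewrite -[in X in _ <= X](big_mkord xpredT (fun t => nat_of_bool (D t))) -/(f N).
have -> : \sum_(t < N) C t = #|[set t : 'I_N | C t]|.
  by rewrite -sum1_card [RHS]big_mkcond; apply: eq_bigr => t _; rewrite inE; case: (C t).
rewrite -[X in _ <= X]card_ord.
pose g (t : 'I_N) : 'I_(f N).+1 := inord (f t).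
rewrite -(@card_in_imset _ _ g); first exact: max_card.
move=> t t'; rewrite !inE => Ct Ct' /(congr1 val); rewrite /= !inordK ?ltnS ?f_le ?(ltnW (ltn_ord _)) //.
move=> eqf; apply/val_inj/eqP; rewrite eqn_leq.
suff H (u v : nat) : C u -> C v -> f u = f v -> u <= v by rewrite !H.
move=> Cu Cv fuv; rewrite leqNgt; apply/negP => ltvu.
have [d Dd /andP[ltvd ltdu]] := CD _ _ Cv Cu ltvu.
by have := fD _ _ Dd ltdu; have := f_le _ _ (ltnW ltvd); lia.
Qed.

(** * Ascending paths as functions on the antidiagonals *)

(* An ascending grid path meets the antidiagonal x + y = t in at most one grid
   point, so it is determined by the column [col t] of that point for
   [start <= t <= stop]; its edge number t joins the antidiagonals t and t + 1. *)
Record staircase := Staircase { start : nat; stop : nat; col : nat -> nat }.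

Definition alive z t := start z <= t < stop z.

Definition staircase_wf z :=
  start z < stop z /\ forall t, alive z t -> col z t <= col z t.+1 <= (col z t).+1.

Definition common_edge z w t :=
  [&& alive z t, alive w t, col z t == col w t & col z t.+1 == col w t.+1].

(** An edge is vertical exactly when the column does not change, so this compares the directions of
    the edges [t.-1] and [t], both of which belong to [z]. *)
Definition turn z t :=
  [&& start z < t, t < stop z & (col z t == col z t.-1) != (col z t.+1 == col z t)].

Definition turns_le k z := forall N, \sum_(t < N) turn z t <= k.

Lemma common_edgeC z w t : common_edge z w t = common_edge w z t.
Proof. by rewrite /common_edge andbCA (eq_sym (col z t)) (eq_sym (col z t.+1)). Qed.

Lemma common_edge_trans w z z' t :
  common_edge z w t -> common_edge w z' t -> common_edge z z' t.
Proof.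
case/and4P=> az aw /eqP e1 /eqP e2 /and4P[_ az' /eqP e3 /eqP e4].
by rewrite /common_edge az az' e1 e2 e3 e4 !eqxx.
Qed.

Definition common_point z w t :=
  [&& start z <= t, t <= stop z, start w <= t, t <= stop w & col z t == col w t].

(** The first alternative is a vertical run, the second a horizontal one: without a turn every edge
    copies the direction of its predecessor. *)
Lemma straight z t t' : staircase_wf z -> start z <= t -> t < t' -> t' <= stop z ->
  (forall u, t < u < t' -> ~~ turn z u) ->
  (forall u, t <= u <= t' -> col z u = col z t) \/
  (forall u, t <= u <= t' -> col z u = col z t + (u - t)).
Proof.
move=> [_ wf] le0 ltt; elim: t' ltt => // t' IH ltt le1 notu.
have stepP := wf t'; rewrite /alive le1 andbT in stepP.
have {stepP} step : col z t' <= col z t'.+1 <= (col z t').+1 by apply: stepP; lia.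
case: (ltngtP t t') => [lt|gt|eqt]; try lia; last first.
  rewrite -{t' IH ltt le1 notu}eqt in step *.
  have [e|ne] := eqVneq (col z t.+1) (col z t); [left|right] => u /andP[u1 u2].
    by have [->|] := eqVneq u t.+1 => // nu; have -> : u = t by lia.
  have [->|nu] := eqVneq u t.+1; first by lia.
  have -> : u = t by lia.
  by lia.
have lt1 : t'.-1.+1 = t' by lia.
have nt : (col z t' == col z t'.-1) = (col z t'.+1 == col z t').
  have := notu t'; rewrite lt ltnS leqnn => /(_ isT).
  rewrite /turn (leq_ltn_trans le0 lt) le1 /=.
  by move/negbNE/eqP.
case: (IH lt (ltnW le1)) => [u /andP[tu ut]|H|H].
- by apply: notu; rewrite tu ltnW.
- left=> u /andP[u1 u2]; have [->|nu] := eqVneq u t'.+1; last by apply: H; lia.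
  have e1 := H t' ltac:(lia); have e2 := H t'.-1 ltac:(lia).
  by move: nt; rewrite e1 e2 eqxx => /esym/eqP.
- right=> u /andP[u1 u2]; have [->|nu] := eqVneq u t'.+1; last by apply: H; lia.
  have e1 := H t' ltac:(lia); have e2 := H t'.-1 ltac:(lia).
  move: nt; rewrite e1 e2 in step *; case: eqP; first by lia.
  by move=> _ /esym/eqP; lia.
Qed.

(* If [z] were straight between two common points, then so would be [w], and
   they would share an edge. *)
Lemma common_points_count N k z w : staircase_wf z -> staircase_wf w ->
  (forall t, ~~ common_edge z w t) -> turns_le k z ->
  \sum_(t < N) common_point z w t <= k.+1.
Proof.
move=> wfz wfw disj zk; apply: (@leq_trans (\sum_(t < N) turn z t).+1); last by rewrite ltnS.
apply: interlaced_count => t t'.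
move=> /and5P[z1 z2 w1 w2 /eqP et] /and5P[z1' z2' w1' w2' /eqP et'] ltt.
case: (pickP (fun u : 'I_t' => (t < u) && turn z u)) => [u /andP[tu zu]|none].
  by exists u => //; rewrite tu ltn_ord.
have nt u : t < u < t' -> ~~ turn z u.
  by case/andP=> u1 u2; have /= := none (Ordinal u2); rewrite u1 /= => ->.
have slope u v : start w <= u -> u <= v -> v <= stop w -> col w u <= col w v <= col w u + (v - u).
  move=> us; elim: v => [|v IH] uv vs.
    by move: uv; rewrite leqn0 => /eqP->; rewrite subnn addn0 leqnn.
  have [->|nu] := eqVneq u v.+1; first by rewrite subnn addn0 leqnn.
  have {}uv : u <= v by lia.
  have := wfw.2 v; rewrite /alive (leq_trans us uv) vs => /(_ isT).
  have := IH uv (ltnW vs); lia.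
(* Between [t] and [t'] the column of [z] grows by 0 or by [t' - t], the extreme values that [slope]
   allows. As [w] has the same growth, its edge [t] is forced to be that of [z]. *)
have /negP[] := disj t.
have s1 := slope t t.+1 w1 (leqnSn _) (leq_trans ltt w2').
have s2 := slope t.+1 t' (leqW w1) ltt w2'.
rewrite /common_edge /alive z1 w1 et eqxx /= (leq_trans ltt z2') (leq_trans ltt w2') /=.
have [H|H] := straight wfz z1 ltt z2' nt.
  have e1 := H t.+1 ltac:(lia); have e2 := H t' ltac:(lia); apply/eqP; lia.
have e1 := H t.+1 ltac:(lia); have e2 := H t' ltac:(lia); apply/eqP; lia.
Qed.

(** * Savings of bends between two consecutive paths *)

(** These are the points of [a] where a path running straight on can part from [a] or join it. *)
Definition leaves a t := (start a < t) && ((t == stop a) || turn a t).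
Definition enters a t := (t < stop a) && ((t == start a) || turn a t).

Section Events.

Variables (N : nat) (b : staircase).
Hypothesis wfb : staircase_wf b.

(** Each event records an edge shared with [b]. Among pairwise edge-disjoint paths this edge
    identifies [b], so different paths have their events at different places. *)
Definition exit_at a t := leaves a t && common_edge a b t.-1.
Definition entry_at a t := enters a t && common_edge a b t.
Definition cross_at a a' t :=
  [&& common_point a a' t, common_edge a b t.-1, common_edge a' b t & 0 < t].

(** With neither a turn nor an end at [t.+1], both paths prolong their common edge [t] in the same
    direction. *)
Lemma common_edge_next a t : staircase_wf a ->
  common_edge a b t -> ~~ turn b t.+1 -> t.+1 < stop b -> ~~ leaves a t.+1 ->
  common_edge a b t.+1.
Proof.
move=> wfa /and4P[/andP[a1 a2] /andP[b1 b2] /eqP e1 /eqP e2] ntb lb.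
rewrite /leaves ltnS a1 /= negb_or => /andP[nst nta].
have la : t.+1 < stop a by lia.
have ea := wfa.2 t.+1; have eb := wfb.2 t.+1.
have ea0 := wfa.2 t; have eb0 := wfb.2 t.
move: ea eb ea0 eb0; rewrite /alive la lb a1 a2 b1 b2 (leqW a1) (leqW b1).
move=> /(_ isT) ea /(_ isT) eb /(_ isT) ea0 /(_ isT) eb0.
move: nta ntb; rewrite /turn !ltnS a1 b1 la lb /= => /negbNE/eqP ta /negbNE/eqP tb.
rewrite /common_edge /alive la lb (leqW a1) (leqW b1) e2 eqxx /=.
apply/eqP; move: ta tb.
by case: eqP; case: eqP; case: eqP; case: eqP => //; lia.
Qed.

Lemma common_edge_prev a t : staircase_wf a ->
  common_edge a b t.+1 -> ~~ turn b t.+1 -> start b <= t -> ~~ enters a t.+1 ->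
  common_edge a b t.
Proof.
move=> wfa /and4P[/andP[a1 a2] /andP[b1 b2] /eqP e1 /eqP e2] ntb lb.
rewrite /enters a2 /= negb_or => /andP[nst nta].
have la : start a <= t by lia.
have ea := wfa.2 t.+1; have eb := wfb.2 t.+1.
have ea0 := wfa.2 t; have eb0 := wfb.2 t.
move: ea eb ea0 eb0; rewrite /alive la lb a1 a2 b1 b2 (ltnW a2) (ltnW b2).
move=> /(_ isT) ea /(_ isT) eb /(_ isT) ea0 /(_ isT) eb0.
move: nta ntb; rewrite /turn !ltnS la lb a2 b2 /= => /negbNE/eqP ta /negbNE/eqP tb.
rewrite /common_edge /alive la lb (ltnW a2) (ltnW b2) e1 eqxx andbT /=.
apply/eqP; move: ta tb.
by case: eqP; case: eqP; case: eqP; case: eqP => //; lia.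
Qed.


Definition exits a := [exists t : 'I_N, exit_at a t].
Definition entries a := [exists t : 'I_N, entry_at a t].
Definition crosses a a' := [exists t : 'I_N, cross_at a a' t].

Variables (a a' : staircase) (t t' : nat).
Hypotheses (wfa : staircase_wf a) (wfa' : staircase_wf a').
Hypothesis disj : forall t, ~~ common_edge a a' t.
Hypotheses (ab : common_edge a b t) (a'b : common_edge a' b t').
Hypotheses (ltt : t < t') (ltN : t' < N).

Let alive_between u : t <= u <= t' -> start b <= u /\ u < stop b.
Proof.
move=> /andP[u1 u2]; case/and4P: ab => _ /andP[b1 _] _ _.
by case/and4P: a'b => _ /andP[_ b2] _ _; split; lia.
Qed.

(** Without an exit of [a], only a turn can take [b] off [a]; [follow_left] is the mirror image for
    [a']. *)
Let follow_right u : ~~ exits a -> t <= u <= t' ->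
  (forall v, t < v <= u -> ~~ turn b v) -> common_edge a b u.
Proof.
move=> /existsPn noexit; elim: u => [|u IH] ut nt.
  by have -> : 0 = t by lia.
have [<-//|neq] := eqVneq t u.+1.
have ltut : u.+1 < N by lia.
have abu : common_edge a b u.
  by apply: IH => [|v vt]; [lia | apply: nt; lia].
apply: common_edge_next => //; first by apply: nt; lia.
  by case: (alive_between ut).
by have := noexit (Ordinal ltut); rewrite /exit_at /= abu andbT.
Qed.

Let follow_left u : ~~ entries a' -> t <= u <= t' ->
  (forall v, u < v <= t' -> ~~ turn b v) -> common_edge a' b u.
Proof.
move=> /existsPn noentry ut.
have [n en] : exists n, u = t' - n by exists (t' - u); lia.
rewrite {u}en in ut *; elim: n ut => [|n IH] ut nt; first by rewrite subn0.
have [le|lt] := leqP t' n.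
  have e : t' - n.+1 = t' - n by lia.
  by rewrite e in ut nt *; apply: IH.
have e : t' - n = (t' - n.+1).+1 by lia.
have ltut : (t' - n.+1).+1 < N by lia.
have abu : common_edge a' b (t' - n.+1).+1.
  by rewrite -e; apply: IH => [|v vt]; [lia | apply: nt; lia].
apply: common_edge_prev => //; first by apply: nt; lia.
  by case: (alive_between ut).
by have := noentry (Ordinal ltut); rewrite /entry_at /= abu andbT.
Qed.

Let no_edge_both u : common_edge a b u -> common_edge a' b u -> False.
Proof.
move=> abu; rewrite common_edgeC => ba'u.
by have /negP[] := disj u; apply: common_edge_trans ba'u.
Qed.

Let turn_between u := (t < u <= t') && turn b u.

Let first_turn : ~~ exits a ->
  exists2 w, turn_between w & common_edge a b w.-1 /\ forall v, turn_between v -> w <= v.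
Proof.
move=> nex; have [|w tw wmin] := @ex_minnP turn_between.
  case: (pickP (fun u : 'I_t'.+1 => turn_between u)) => [u tu|none]; first by exists u.
  (* Without a turn [b] would still be on [a] at the edge [t'], which it also shares with [a']. *)
  case: (@no_edge_both t') => //; apply: follow_right => //; first by rewrite ltnW /=.
  move=> v vt; apply/negP => tv; have ltv : v < t'.+1 by lia.
  by have := none (Ordinal ltv); rewrite /turn_between vt tv.
exists w => //; split => //; apply: follow_right => //; first by case/andP: tw; lia.
case/andP: tw => w_in _ v vt; apply/negP => tv.
by have := wmin v; rewrite /turn_between tv andbT; lia.
Qed.

Let last_turn : ~~ entries a' ->
  exists2 w, turn_between w & common_edge a' b w /\ forall v, turn_between v -> v <= w.
Proof.
move=> nen; have le_t' v : turn_between v -> v <= t' by case/andP=> /andP[].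
have [|w tw wmax] := @ex_maxnP turn_between t' _ le_t'.
  case: (pickP (fun u : 'I_t'.+1 => turn_between u)) => [u tu|none]; first by exists u.
  case: (@no_edge_both t) => //; apply: follow_left => //; first by rewrite leqnn ltnW.
  move=> v vt; apply/negP => tv; have ltv : v < t'.+1 by lia.
  by have := none (Ordinal ltv); rewrite /turn_between vt tv.
exists w => //; split => //; apply: follow_left => //; first by case/andP: tw; lia.
case/andP: tw => w_in _ v vt; apply/negP => tv.
by have := wmax v; rewrite /turn_between tv andbT; lia.
Qed.

Let turns_between_gt0 m n w : m <= w < n -> turn b w -> 0 < \sum_(m <= u < n) turn b u.
Proof.
by move=> /andP[mw wn] tw; rewrite (@big_cat_nat _ _ _ w) ?(ltnW wn) //= (big_ltn wn) tw; lia.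
Qed.

(* If [b] leaves [a] or reaches [a'] along a straight line, then [a] or [a'] turns
   or ends there; otherwise [b] turns there, and if it turns only once, then the
   turn is a common point of [a] and [a']. *)
Lemma gap_events :
  2 <= exits a + entries a' + crosses a a' + \sum_(t.+1 <= u < t'.+1) turn b u.
Proof.
set s := bigop _ _ _.
have s1 w : turn_between w -> 0 < s.
  by case/andP=> /andP[w1 w2]; apply: turns_between_gt0; rewrite w1.
have s2 w w' : w < w' -> turn_between w -> turn_between w' -> 1 < s.
  move=> ww /andP[/andP[w1 w2] tw] /andP[/andP[w1' w2'] tw'].
  rewrite /s (@big_cat_nat _ _ _ w') //=; try lia.
  have := @turns_between_gt0 t.+1 w' w; have := @turns_between_gt0 w' t'.+1 w'.
  by rewrite w1 ww leqnn ltnS w2' => /(_ isT tw') + /(_ isT tw); lia.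
have [ex|nex] := boolP (exits a); have [en|nen] := boolP (entries a') => //.
- by have [w /s1] := last_turn nen; lia.
- by have [w /s1] := first_turn nex; lia.
have [w tw [abw wmin]] := first_turn nex; have [w' tw' [abw' wmax]] := last_turn nen.
have [lt|gt|eqw] := ltngtP w w'; first by have := s2 _ _ lt tw tw'; lia.
  by have := wmin _ tw'; lia.
suff -> : crosses a a' by have := s1 _ tw; lia.
rewrite -{}eqw in abw'; case/andP: tw => /andP[w1 w2] _; have ltw : w < N by lia.
apply/existsP; exists (Ordinal ltw); rewrite /cross_at /= abw abw' andbC /= (leq_ltn_trans _ w1) //=.
case/and4P: abw => /andP[c1 c2] _ _ /eqP; case/and4P: abw' => /andP[d1 d2] _ /eqP d3 _.
have ew : w.-1.+1 = w by lia.
rewrite ew => c3; rewrite /common_point d1 (ltnW d2) c3 d3 eqxx andbT /=.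
by apply/andP; split; lia.
Qed.

End Events.

(** * Double counting of the savings *)

Section Counting.

Variables (A Bt : finType) (k m : nat).
Variables (PA : A -> staircase) (PB : Bt -> staircase).
(** [sigma b] lists [m] members of [A] met by [b], and [E] contains the ordered pairs formed from
    such a list. Crossings need to be bounded on these pairs only. *)
Variables (sigma : Bt -> 'I_m -> A) (E : {set A * A}).
Hypothesis wfA : forall a, staircase_wf (PA a).
Hypothesis wfB : forall b, staircase_wf (PB b).
Hypothesis turnsA : forall a, turns_le k (PA a).
Hypothesis turnsB : forall b, turns_le k (PB b).
Hypothesis disjA : forall a a' t, a != a' -> ~~ common_edge (PA a) (PA a') t.
Hypothesis disjB : forall b b' t, b != b' -> ~~ common_edge (PB b) (PB b') t.
Hypothesis sigma_inj : forall b, injective (sigma b).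
Hypothesis sigmaP : forall b i, exists t, common_edge (PA (sigma b i)) (PB b) t.
Hypothesis sigmaE : forall b i i', i != i' -> (sigma b i, sigma b i') \in E.

(** The successor leaves room for an exit at [t = stop (PA a)]. *)
Let N := (\max_a stop (PA a)).+1.

Let stopN a : stop (PA a) < N.
Proof. by rewrite ltnS; apply: leq_bigmax. Qed.

(** [E] may contain diagonal pairs. The test [a != a'] discards them, since the bound on common
    points is for edge-disjoint paths. *)
Let crossing b a a' := (a != a') && crosses N (PB b) (PA a) (PA a').

(** This adds up [gap_events] over consecutive members. No resource is used twice: a gap takes an
    exit of its left member, an entry of its right member, their crossing, and the turns of an
    interval of its own. *)
Lemma chain_events b (tau : A -> nat) x l :
  {in x :: l, forall a, common_edge (PA a) (PB b) (tau a)} ->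
  path (fun a a' => tau a < tau a') x l ->
  2 * size l <= \sum_(a <- x :: l) exits N (PB b) (PA a)
    + \sum_(a <- l) entries N (PB b) (PA a)
    + \sum_(a <- x :: l) \sum_(a' <- x :: l) crossing b a a'
    + \sum_((tau x).+1 <= u < N) turn (PB b) u.
Proof.
elim: l x => [|y l IH] x //= meets /andP[ltxy pl].
have tauN a : a \in [:: x, y & l] -> tau a < N.
  by move=> /meets /and4P[/andP[_ lt] _ _ _]; apply: ltn_trans lt (stopN a).
have IHl : {in y :: l, forall a, common_edge (PA a) (PB b) (tau a)}.
  by move=> a al; apply: meets; rewrite inE al orbT.
have {IH} := IH y IHl pl.
have neq : x != y by apply: contraTneq ltxy => ->; rewrite ltnn.
have := gap_events (wfB b) (wfA x) (wfA y) (fun t => disjA t neq)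
  (meets x _) (meets y _) ltxy (tauN y _).
rewrite !inE !eqxx !orbT => /(_ isT isT isT).
have lt_yN : tau y < N by apply: tauN; rewrite !inE eqxx orbT.
rewrite [\sum_((tau x).+1 <= u < N) _](@big_cat_nat _ _ _ (tau y).+1 (tau x).+1 _ _ _ (ltnW ltxy) lt_yN) /=.
have : \sum_(a <- l) \sum_(a' <- y :: l) crossing b a a' <=
   \sum_(a <- l) \sum_(a' <- [:: x, y & l]) crossing b a a'.
  by apply: leq_sum => a _; rewrite [leqRHS]big_cons leq_addl.
rewrite !big_cons.
have -> : crossing b x y = crosses N (PB b) (PA x) (PA y) by rewrite /crossing neq.
set s1 := \sum_(a <- l) \sum_(a' <- y :: l) _; set s2 := \sum_(a <- l) \sum_(a' <- [:: x, y & l]) _.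
set s3 := \sum_(a' <- l) crossing b x _; set s4 := \sum_(a' <- l) crossing b y _.
set s5 := \sum_(a <- l) exits _ _ _; set s6 := \sum_(a <- l) entries _ _ _.
set s7 := \sum_(_ <= _ < (tau y).+1) _; set s8 := \sum_(_ <= _ < N) _.
move: s1 s2 s3 s4 s5 s6 s7 s8 (crossing b x x) (crossing b y x) (crossing b y y).
lia.
Qed.

Let points_events b : 2 * m.-1 <= \sum_a exits N (PB b) (PA a)
    + \sum_a entries N (PB b) (PA a)
    + \sum_(p in E) crossing b p.1 p.2 + k.
Proof.
have stopNat a t : common_edge (PA a) (PB b) t -> t < N.
  by move=> /and4P[/andP[_ lt] _ _ _]; apply: ltn_trans lt (stopN a).
(* The position of some edge shared with [b]; the default 0 occurs only outside [S]. *)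
pose tau a : nat := if [pick t : 'I_N | common_edge (PA a) (PB b) t] is Some t then t else 0.
pose S := [seq sigma b i | i <- enum 'I_m].
have tauP a : a \in S -> common_edge (PA a) (PB b) (tau a).
  move=> /mapP[i _ ->]; rewrite /tau; case: pickP => // none.
  have [t ct] := sigmaP b i.
  by have := none (Ordinal (stopNat _ _ ct)); rewrite /= ct.
have uS : uniq S by rewrite map_inj_uniq ?enum_uniq //; apply: sigma_inj.
(* Members of [A] sharing the same edge of [b] would share it with each other. Hence the positions
   differ, and sorting by them gives a strictly increasing chain. *)
have tau_inj : {in S &, injective tau}.
  move=> a a' /tauP ca /tauP ca' eqt; apply/eqP/negPn/negP => neq.
  have /negP[] := disjA (tau a) neq; apply: common_edge_trans ca _.
  by rewrite common_edgeC eqt.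
pose l := sort (relpre tau leq) S.
have memS : l =i S by apply: mem_sort.
have ul : uniq l by rewrite sort_uniq.
have sl : sorted (relpre tau ltn) l.
  rewrite -sorted_map ltn_sorted_uniq_leq map_inj_in_uniq ?ul /=; last first.
    by move=> a a'; rewrite !memS; apply: tau_inj.
  by rewrite sorted_map; apply: sort_sorted => a a'; apply: leq_total.
have szl : size l = m by rewrite size_sort size_map size_enum_ord.
have lE a a' : a \in l -> a' \in l -> a != a' -> (a, a') \in E.
  rewrite !memS => /mapP[i _ ->] /mapP[i' _ ->] neq; apply: sigmaE.
  by apply: contraNneq neq => ->.
have pairs_le : \sum_(a <- l) \sum_(a' <- l) crossing b a a' <=
    \sum_(p in E) crossing b p.1 p.2.
  rewrite big_uniq //=; under eq_bigr do rewrite big_uniq //=.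
  rewrite pair_big_dep /= [leqRHS]big_mkcond [leqLHS]big_mkcond /=.
  apply: leq_sum => -[a a'] _ /=; case: andP => // -[al a'l].
  by case: (eqVneq a a') => [->|neq]; [rewrite /crossing eqxx | rewrite lE].
have sub_sum (f : A -> bool) l' : uniq l' -> \sum_(a <- l') f a <= \sum_a f a.
  move=> ul'; rewrite big_uniq // [leqRHS](bigID (mem l')) /=; exact: leq_addr.
have turns_le_k u : \sum_(u <= v < N) turn (PB b) v <= k.
  apply: leq_trans (turnsB b N); rewrite -(big_mkord xpredT (fun v => nat_of_bool (turn (PB b) v))).
  have [le|lt] := leqP u N; last by rewrite big_geq // ltnW.
  by rewrite [leqRHS](@big_cat_nat _ _ _ u) //=; apply: leq_addl.
case def_l : l => [|x l']; rewrite def_l /= in szl; rewrite -szl //=.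
have l'P a : a \in x :: l' -> a \in S by rewrite -def_l memS.
have pl' : path (relpre tau ltn) x l' by rewrite def_l in sl.
have := chain_events (fun a al => tauP a (l'P a al)) pl'.
rewrite -def_l => chain; apply: leq_trans chain _.
apply: leq_add (turns_le_k _); apply: leq_add pairs_le.
by apply: leq_add; apply: sub_sum => //; rewrite def_l in ul; case/andP: ul.
Qed.

Let common_edge_uniq a b b' t :
  common_edge (PA a) (PB b) t -> common_edge (PA a) (PB b') t -> b = b'.
Proof.
rewrite common_edgeC => ba ab'; apply/eqP/negPn/negP => neq.
by have /negP[] := disjB t neq; apply: common_edge_trans ba ab'.
Qed.

Let ends_le (z : staircase) e : turns_le k z ->
  \sum_(t < N) ((t == e :> nat) || turn z t) <= k.+1.
Proof.
move=> zk; apply: (@leq_trans (\sum_(t < N) (t == e :> nat) + \sum_(t < N) turn z t)).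
  by rewrite -big_split; apply: leq_sum => t _; case: (_ == _); case: (turn z t).
rewrite -add1n leq_add ?zk //; case: (ltnP e N) => [lt|le]; last first.
  by rewrite big1 // => t _; apply/eqP; rewrite eqb0; apply: contraTneq (ltn_ord t) => ->; rewrite -leqNgt.
rewrite (bigD1 (Ordinal lt)) //= eqxx big1 // => t; rewrite -val_eqE /=.
by move/negbTE->.
Qed.

(** Sum [points_events] over all [b] and exchange the sums. Exits and entries are charged to the
    turns and to one end of [a], at most [k.+1] each; crossings are charged to the at most [k.+1]
    common points of a pair in [E]. No charge is made by two different [b]. *)
Lemma staircases_count :
  #|Bt| * (2 * m.-1) <= k * #|Bt| + k.+1 * (2 * #|A| + #|E|).
Proof.
apply: (@leq_trans (\sum_b (\sum_a exits N (PB b) (PA a)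
    + \sum_a entries N (PB b) (PA a)
    + \sum_(p in E) crossing b p.1 p.2 + k))).
  by rewrite -sum_nat_const; apply: leq_sum => b _; apply: points_events.
rewrite !big_split /= sum_nat_const (mulnC #|Bt|) addnC leq_add2l.
rewrite mulnDr mulnA (mulnC _ 2) mul2n -addnn mulnDl; apply: leq_add; first apply: leq_add.
- rewrite exchange_big mulnC -sum_nat_const; apply: leq_sum => a _ /=.
  apply: leq_trans (ends_le (stop (PA a)) (turnsA a)).
  apply: (@leq_trans (\sum_(t < N) leaves (PA a) t)).
    apply: (sum_exists_le (P := fun t : 'I_N => leaves (PA a) t)
      (Q := fun b (t : 'I_N) => common_edge (PA a) (PB b) t.-1)) => t _ b b'.
    exact: common_edge_uniq.
  by apply: leq_sum => t _; rewrite /leaves; case: (_ < _).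
- rewrite exchange_big mulnC -sum_nat_const; apply: leq_sum => a _ /=.
  apply: leq_trans (ends_le (start (PA a)) (turnsA a)).
  apply: (@leq_trans (\sum_(t < N) enters (PA a) t)).
    apply: (sum_exists_le (P := fun t : 'I_N => enters (PA a) t)
      (Q := fun b (t : 'I_N) => common_edge (PA a) (PB b) t)) => t _ b b'.
    exact: common_edge_uniq.
  by apply: leq_sum => t _; rewrite /enters; case: (_ < _).
rewrite exchange_big mulnC -sum_nat_const; apply: leq_sum => -[a a'] /= aa'.
case: (eqVneq a a') => [->|neq]; first by rewrite big1 // => b _; rewrite /crossing eqxx.
apply: leq_trans (common_points_count N (wfA a) (wfA a') (fun t => disjA t neq) (turnsA a)).
apply: leq_trans (sum_exists_le (P := fun t : 'I_N => common_point (PA a) (PA a') t)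
  (Q := fun b (t : 'I_N) => common_edge (PA a) (PB b) t.-1) _); last first.
  by move=> t _ b b'; apply: common_edge_uniq.
apply: leq_sum => b _; rewrite /crossing neq /= /crosses.
case: existsP => //= -[t /and4P[ct at_ _ _]].
by case: existsP => //; case; exists t; rewrite ct.
Qed.

End Counting.

(** * Edges and reversal of grid paths *)

Section Steps.

Variable T : Type.
Implicit Types (s : seq T) (x : T).

(** Applied to an edge this reverses its orientation; applied to a grid point it reflects in the
    diagonal. *)
Definition flip (e : T * T) := (e.2, e.1).

Lemma flipK : involutive flip.
Proof. by case. Qed.

Lemma steps_rcons2 s x y : steps (rcons (rcons s x) y) = rcons (steps (rcons s x)) (x, y).
Proof. by elim: s => [|z [|z' s] IH] //=; move: IH; rewrite /steps /= => ->. Qed.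

Lemma steps_rev s : steps (rev s) = rev (map flip (steps s)).
Proof.
elim: s => [|x [|y s] IH] //.
by rewrite rev_cons {1}rev_cons steps_rcons2 -rev_cons IH -rev_cons.
Qed.

Lemma steps_nth x0 s : steps s = mkseq (fun i => (nth x0 s i, nth x0 s i.+1)) (size s).-1.
Proof.
elim: s => [|x [|y s] IH] //.
rewrite -[steps _]/((x, y) :: steps (y :: s)) IH /mkseq /= (iotaDl 1 0) -map_comp.
by [].
Qed.

Lemma size_steps s : size (steps s) = (size s).-1.
Proof. by rewrite size_zip size_behead; apply/minn_idPr/leq_pred. Qed.

End Steps.

Arguments flip {T} e.
Arguments flipK {T} x.

Lemma map_steps (T U : Type) (f : T -> U) s :
  steps (map f s) = map (fun e => (f e.1, f e.2)) (steps s).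
Proof. by elim: s => [|x [|y s] IH] //; rewrite /= in IH *; rewrite -IH. Qed.

Lemma stepsP (T : eqType) (x0 : T) (s : seq T) (e : T * T) :
  reflect (exists2 i, i.+1 < size s & e = (nth x0 s i, nth x0 s i.+1)) (e \in steps s).
Proof.
rewrite (steps_nth x0); apply: (iffP mapP) => -[i lti ->]; exists i => //.
  by move: lti; rewrite mem_iota; lia.
by rewrite mem_iota; lia.
Qed.

Lemma mem_steps_rev (T : eqType) (s : seq T) e : (e \in steps (rev s)) = (flip e \in steps s).
Proof. by rewrite steps_rev mem_rev -{1}[e]flipK (mem_map (can_inj flipK)). Qed.

Lemma gadjC : symmetric gadj.
Proof. by move=> [x y] [x' y']; rewrite /gadj /=; lia. Qed.

Lemma gpath_rev s : gpath (rev s) = gpath s.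
Proof.
rewrite /gpath size_rev rev_uniq rev_sorted.
by congr [&& _, _ & _]; apply: eq_sorted => p q; rewrite gadjC.
Qed.

Lemma bends_rev s : bends (rev s) = bends s.
Proof.
rewrite /bends steps_rev steps_rev count_rev map_steps !count_map.
apply: eq_count => -[[p q] [p' q']] /=; rewrite /horizontal /=.
by rewrite eq_sym (eq_sym q'.2) (eq_sym q.2).
Qed.

Lemma share_edgeP s t :
  reflect (exists2 e, e \in steps s & (e \in steps t) || (flip e \in steps t)) (share_edge s t).
Proof. exact: hasP. Qed.

Lemma share_edgeC : symmetric share_edge.
Proof.
suff H s t : share_edge s t -> share_edge t s by move=> s t; apply/idP/idP; apply: H.
move=> /share_edgeP[[p q] es /orP[et|et]]; apply/share_edgeP.
  by exists (p, q); rewrite ?es.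
by exists (q, p); rewrite ?es ?orbT.
Qed.

Lemma share_edge_revl s t : share_edge (rev s) t = share_edge s t.
Proof.
suff H u : share_edge u t -> share_edge (rev u) t.
  by apply/idP/idP; [rewrite -{2}(revK s)|]; apply: H.
move=> /share_edgeP[[p q] es et]; apply/share_edgeP; exists (q, p); rewrite ?mem_steps_rev //.
by rewrite orbC.
Qed.

Definition ascend s := if ascending s then s else rev s.

Lemma ascendP s : monotonic s -> ascending (ascend s).
Proof. by rewrite /ascend /monotonic; case: ifP. Qed.

Lemma gpath_ascend s : gpath (ascend s) = gpath s.
Proof. by rewrite /ascend; case: ifP => // _; rewrite gpath_rev. Qed.

Lemma bends_ascend s : bends (ascend s) = bends s.
Proof. by rewrite /ascend; case: ifP => // _; rewrite bends_rev. Qed.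

Lemma share_edge_ascend s t : share_edge (ascend s) (ascend t) = share_edge s t.
Proof.
have H u v : share_edge (ascend u) v = share_edge u v.
  by rewrite /ascend; case: ifP => // _; rewrite share_edge_revl.
by rewrite H share_edgeC H share_edgeC.
Qed.

(** * From ascending grid paths to staircases *)

Definition o : gpoint := (0, 0).

(** [d] is the antidiagonal of the first point, so list index [i] becomes [t = d + i]. Columns
    outside [start] and [stop] are junk values that no predicate on staircases inspects. *)
Definition staircase_of (s : seq gpoint) :=
  let d := (head o s).1 + (head o s).2 in
  Staircase d (d + (size s).-1) (fun t => (nth o s (t - d)).1).

Section Ascending.

Variable s : seq gpoint.
Hypotheses (gs : gpath s) (asc : ascending s).

Let step_gadj i : i.+1 < size s -> gadj (nth o s i) (nth o s i.+1).
Proof. by case/and3P: gs => _ /(sortedP o) + _; apply. Qed.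

Let step_asc i : i.+1 < size s ->
  (nth o s i).1 <= (nth o s i.+1).1 /\ (nth o s i).2 <= (nth o s i.+1).2.
Proof. by move=> lti; apply/andP; have /(sortedP o) := asc; apply. Qed.

Lemma ascending_step i : i.+1 < size s ->
  nth o s i.+1 = ((nth o s i).1.+1, (nth o s i).2) \/
  nth o s i.+1 = ((nth o s i).1, (nth o s i).2.+1).
Proof.
move=> lti; have := step_gadj lti; have := step_asc lti.
case: (nth o s i) => x y; case: (nth o s i.+1) => x' y'; rewrite /gadj /= => -[le1 le2].
by case/orP => /andP[/eqP e] /orP[] /eqP e'; [left|lia|right|lia]; congr pair; lia.
Qed.

Lemma antidiagonal i : i < size s ->
  (nth o s i).1 + (nth o s i).2 = start (staircase_of s) + i.
Proof.
elim: i => [|i IH] lti /=; first by rewrite nth0 addn0.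
have := IH (ltnW lti) => /=.
by case: (ascending_step lti) => -> /=; lia.
Qed.

Lemma staircase_of_wf : staircase_wf (staircase_of s).
Proof.
split=> /=; first by case/and3P: gs; lia.
move=> t /andP[/= t1 t2]; set d := _ + _ in t1 t2 *.
rewrite subSn //; case: (@ascending_step (t - d)) => [|->|->] /=; lia.
Qed.

Lemma bendsE : bends s =
  size [seq i <- iota 0 (size s).-2 |
    horizontal (nth o s i, nth o s i.+1) != horizontal (nth o s i.+1, nth o s i.+2)].
Proof.
rewrite /bends (steps_nth (o, o)) size_steps (steps_nth o s) size_filter count_map.
apply: eq_in_count => i; rewrite mem_iota /= => lti.
by rewrite !nth_mkseq //; lia.
Qed.

Lemma staircase_of_turns : turns_le (bends s) (staircase_of s).
Proof.
move=> N; rewrite bendsE -(big_mkord xpredT (fun t => nat_of_bool (turn (staircase_of s) t))).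
have -> : \sum_(0 <= t < N) turn (staircase_of s) t =
    size [seq t <- iota 0 N | turn (staircase_of s) t].
  by rewrite size_filter -sum1_count [RHS]big_mkcond /index_iota subn0; apply: eq_bigr => t _; case: turn.
(* A bend is indexed by the first of three consecutive points, hence the successor: index [i] is a
   turn at [start + i + 1]. *)
rewrite -[leqRHS](size_map (addn (start (staircase_of s)).+1)); apply: uniq_leq_size.
  by rewrite filter_uniq ?iota_uniq.
move=> t; rewrite mem_filter => /andP[/and3P[]] /=; set d := _ + _ => t1 t2 neq _.
apply/mapP; exists (t - d.+1); last by lia.
rewrite mem_filter mem_iota; apply/andP; split; last by lia.
have e1 : t.-1 - d = t - d.+1 by lia.
have e2 : t - d = (t - d.+1).+1 by lia.
have e3 : t.+1 - d = (t - d.+1).+2 by lia.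
move: neq; rewrite e1 e2 e3 /horizontal /=.
have [|-> | ->] := @ascending_step (t - d.+1).+1; first by lia.
  by have [|-> | ->] := @ascending_step (t - d.+1) => /=; lia.
by have [|-> | ->] := @ascending_step (t - d.+1) => /=; lia.
Qed.

End Ascending.

Lemma col_staircase_of s i :
  col (staircase_of s) (start (staircase_of s) + i) = (nth o s i).1.
Proof. by rewrite /= addKn. Qed.

Lemma alive_staircase_of s i :
  alive (staircase_of s) (start (staircase_of s) + i) = (i.+1 < size s).
Proof. by rewrite /alive leq_addr ltn_add2l ltn_predRL. Qed.

(** Ascending paths traverse each edge upwards, so a shared edge has the same orientation in both.
    Points on one antidiagonal coincide as soon as their columns agree. *)
Lemma share_edge_staircase s t : gpath s -> ascending s -> gpath t -> ascending t ->
  reflect (exists u, common_edge (staircase_of s) (staircase_of t) u) (share_edge s t).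
Proof.
move=> gs ass gt ast; have ads := antidiagonal gs ass; have adt := antidiagonal gt ast.
apply: (iffP (share_edgeP _ _)) => [[e] | [u]].
  move=> /(stepsP o)[i lti ->] /orP[] /(stepsP o)[j ltj] [e1 e2]; last first.
    have := ads _ (ltnW lti); have := ads _ lti; rewrite e1 e2 !adt ?(ltnW ltj) //; lia.
  exists (start (staircase_of s) + i).
  have eqd : start (staircase_of s) + i = start (staircase_of t) + j.
    by rewrite -ads ?e1 ?adt // ltnW.
  have eqd' : start (staircase_of s) + i.+1 = start (staircase_of t) + j.+1.
    by rewrite !addnS eqd.
  apply/and4P; split.
  - by rewrite alive_staircase_of.
  - by rewrite eqd alive_staircase_of.
  - by rewrite [in X in _ == X]eqd !col_staircase_of e1.
  - by rewrite -addnS [in X in _ == X]eqd' !col_staircase_of e2.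
case/and4P => as_ at_ /eqP c1 /eqP c2.
have [[u1 _] [u3 _]] := (andP as_, andP at_).
have [i ei] : exists i, u = start (staircase_of s) + i.
  by exists (u - start (staircase_of s)); lia.
have [j ej] : exists j, u = start (staircase_of t) + j.
  by exists (u - start (staircase_of t)); lia.
have lti : i.+1 < size s by rewrite -alive_staircase_of -ei.
have ltj : j.+1 < size t by rewrite -alive_staircase_of -ej.
have same l l' : l < size s -> l' < size t ->
    start (staircase_of s) + l = start (staircase_of t) + l' ->
    col (staircase_of s) (start (staircase_of s) + l) =
    col (staircase_of t) (start (staircase_of s) + l) -> nth o s l = nth o t l'.
  move=> lt1 lt2 eql; rewrite [in RHS]eql !col_staircase_of => eqc.
  have := ads _ lt1; have := adt _ lt2; rewrite eql -eqc => <-.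
  case: (nth o s l) (nth o t l') eqc => x y [x' y'] /= -> /addnI.
  by move=> ->.
exists (nth o s i, nth o s i.+1); first by apply/(stepsP o); exists i.
apply/orP; left; apply/(stepsP o); exists j => //.
by congr pair; apply: same; rewrite ?(ltnW lti) ?(ltnW ltj) // ?addnS -?ei -?ej.
Qed.

Lemma Bm_sub_B k G : Bm k G -> B k G.
Proof. by case=> P [rP mP]; exists P; split=> // v; case: (mP v). Qed.

(** * Intersection graphs and the bound for ascending representations *)

Section IntersectionGraph.

Variables (V : finType) (P : V -> seq gpoint).

Definition edge_meet : rel V := fun v w => (v != w) && share_edge (P v) (P w).

Lemma edge_meet_sym : symmetric edge_meet.
Proof. by move=> v w; rewrite /edge_meet eq_sym share_edgeC. Qed.

Lemma edge_meet_irrefl : irreflexive edge_meet.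
Proof. by move=> v; rewrite /edge_meet eqxx. Qed.

Definition intersection_graph := SGraph edge_meet_sym edge_meet_irrefl.

Lemma intersection_graph_B k :
  (forall v, gpath (P v)) -> (forall v, bends (P v) <= k) -> B k intersection_graph.
Proof.
move=> gP bP; exists P; split=> //; split=> // v w neq.
by rewrite /= /edge_meet neq.
Qed.

End IntersectionGraph.

(** The hypotheses on [P] speak only of adjacency in its intersection graph, so they pass to any
    ascending representation [Q] of this graph, and the count applies to the staircases of [Q]. *)
Lemma monotonic_count (A Bt : finType) (k m : nat) (P : A + Bt -> seq gpoint)
    (sigma : Bt -> 'I_m -> A) (E : {set A * A}) :
  (forall a a', a != a' -> ~~ share_edge (P (inl a)) (P (inl a'))) ->
  (forall b b', b != b' -> ~~ share_edge (P (inr b)) (P (inr b'))) ->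
  (forall b, injective (sigma b)) ->
  (forall b i, share_edge (P (inl (sigma b i))) (P (inr b))) ->
  (forall b i i', i != i' -> (sigma b i, sigma b i') \in E) ->
  Bm k (intersection_graph P) ->
  #|Bt| * (2 * m.-1) <= k * #|Bt| + k.+1 * (2 * #|A| + #|E|).
Proof.
move=> indA indB injs meets sE [Q [[gQ adjQ] mQ]].
have gA v : gpath (ascend (Q v)) by rewrite gpath_ascend.
have aA v : ascending (ascend (Q v)) by apply: ascendP; case: (mQ v).
pose z v := staircase_of (ascend (Q v)).
have wfz v : staircase_wf (z v) by apply: staircase_of_wf.
have turnz v : turns_le k (z v).
  move=> N; apply: leq_trans (staircase_of_turns (gA v) (aA v) N) _.
  by rewrite bends_ascend; case: (mQ v).
have meetz v w : v != w -> reflect (exists u, common_edge (z v) (z w) u) (share_edge (P v) (P w)).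
  move=> neq; have /= := adjQ v w neq; rewrite /edge_meet neq /= => ->.
  by rewrite -share_edge_ascend; apply: share_edge_staircase.
have disjz v w : v != w -> ~~ share_edge (P v) (P w) -> forall t, ~~ common_edge (z v) (z w) t.
  by move=> neq /(meetz _ _ neq) ns t; apply/negP => ct; apply: ns; exists t.
apply: (@staircases_count A Bt k m (z \o inl) (z \o inr) sigma E) => //=.
- by move=> a a' t neq; apply: disjz; rewrite ?indA.
- by move=> b b' t neq; apply: disjz; rewrite ?indB.
- by move=> b i; apply/meetz.
Qed.

(** * Unit edges, and routes given by their corners *)

Definition has_edge (s : seq gpoint) e := (e \in steps s) || (flip e \in steps s).
(** An undirected edge is named by its left or lower end. *)
Definition hedge s x y := has_edge s ((x, y), (x.+1, y)).
Definition vedge s x y := has_edge s ((x, y), (x, y.+1)).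

Lemma share_edgeE s t : sorted gadj s ->
  reflect (exists x y, hedge s x y && hedge t x y || vedge s x y && vedge t x y) (share_edge s t).
Proof.
move=> gs; apply: (iffP (share_edgeP _ _)) => [[[p q] es et]|[x [y]]].
  have {gs} : gadj p q.
    by case/(stepsP o): es => i lti [-> ->]; move: i lti; apply/sortedP.
  have es' : has_edge s (p, q) && has_edge t (p, q) by rewrite /has_edge es.
  have es2 : has_edge s (q, p) && has_edge t (q, p).
    by move: es'; rewrite /has_edge /flip /= orbC [in X in _ && X]orbC.
  case: p q es' es2 {es et} => x y [x' y'] es' es2; rewrite /gadj /=.
  case/orP => /andP[/eqP e /orP[/eqP e'|/eqP e']]; subst.
  - by exists x, y'; rewrite /hedge es'.
  - by exists x', y'; rewrite /hedge es2.
  - by exists x', y; rewrite /vedge es' orbT.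
  - by exists x', y'; rewrite /vedge es2 orbT.
have W e : has_edge s e -> has_edge t e ->
    exists2 e, e \in steps s & (e \in steps t) || (flip e \in steps t).
  move=> /orP[es|es] et; first by exists e.
  by exists (flip e) => //; rewrite flipK orbC.
by case/orP => /andP[]; apply: W.
Qed.

Lemma share_hedge s t x y : sorted gadj s -> hedge s x y -> hedge t x y -> share_edge s t.
Proof. by move=> gs hs ht; apply/share_edgeE => //; exists x, y; rewrite hs ht. Qed.

Lemma share_vedge s t x y : sorted gadj s -> vedge s x y -> vedge t x y -> share_edge s t.
Proof. by move=> gs hs ht; apply/share_edgeE => //; exists x, y; rewrite hs ht orbT. Qed.

Lemma gpath_sorted s : gpath s -> sorted gadj s.
Proof. by case/and3P. Qed.

Section Routes.

Implicit Types (p q r : gpoint) (cs : seq gpoint).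

(** The exclusive or also rules out [p = q], so every segment has an edge. *)
Definition axis p q := (p.1 == q.1) (+) (p.2 == q.2).
Definition toward a b i := if a <= b then minn (a + i) b else maxn (a - i) b.
Definition point_at p q i : gpoint := (toward p.1 q.1 i, toward p.2 q.2 i).
Definition dist p q := (p.1 - q.1) + (q.1 - p.1) + ((p.2 - q.2) + (q.2 - p.2)).
(** The first point is left out, so that concatenated segments list each corner once. *)
Definition seg p q := mkseq (fun i => point_at p q i.+1) (dist p q).

Fixpoint trail p cs := if cs is q :: cs' then seg p q ++ trail q cs' else [::].
Definition route cs := if cs is p :: cs' then p :: trail p cs' else [::].

Lemma toward0 a b : toward a b 0 = a.
Proof. by rewrite /toward; case: ifP; lia. Qed.

Lemma towardxx a i : toward a a i = a.
Proof. by rewrite /toward leqnn; lia. Qed.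

Lemma cons_seg p q : p :: seg p q = mkseq (point_at p q) (dist p q).+1.
Proof.
rewrite /mkseq /= /point_at !toward0 (iotaDl 1 0) -map_comp; case: p => x y.
by [].
Qed.

Variant axis_spec p q : Prop :=
  | AxisRight n of q = (p.1 + n.+1, p.2) & dist p q = n.+1
      & (forall i, i <= n.+1 -> point_at p q i = (p.1 + i, p.2))
  | AxisLeft n of p = (q.1 + n.+1, q.2) & dist p q = n.+1
      & (forall i, i <= n.+1 -> point_at p q i = (p.1 - i, p.2))
  | AxisUp n of q = (p.1, p.2 + n.+1) & dist p q = n.+1
      & (forall i, i <= n.+1 -> point_at p q i = (p.1, p.2 + i))
  | AxisDown n of p = (q.1, q.2 + n.+1) & dist p q = n.+1
      & (forall i, i <= n.+1 -> point_at p q i = (p.1, p.2 - i)).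

Lemma axisP p q : axis p q -> axis_spec p q.
Proof.
case: p q => a b [c d]; rewrite /axis /=; case: (ltngtP a c) => ac; case: (ltngtP b d) => bd //= _.
- apply: (AxisRight (n := c - a.+1)); rewrite /dist /= ?bd; [congr pair; lia|lia|].
  by move=> i lei; rewrite /point_at /= towardxx /toward; congr pair; case: ifP; lia.
- apply: (AxisLeft (n := a - c.+1)); rewrite /dist /= ?bd; [congr pair; lia|lia|].
  by move=> i lei; rewrite /point_at /= towardxx /toward; congr pair; case: ifP; lia.
- apply: (AxisUp (n := d - b.+1)); rewrite /dist /= ?ac; [congr pair; lia|lia|].
  by move=> i lei; rewrite /point_at /= towardxx /toward; congr pair; case: ifP; lia.
- apply: (AxisDown (n := b - d.+1)); rewrite /dist /= ?ac; [congr pair; lia|lia|].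
  by move=> i lei; rewrite /point_at /= towardxx /toward; congr pair; case: ifP; lia.
Qed.


Lemma nth_cons_seg p q i : i <= dist p q -> nth o (p :: seg p q) i = point_at p q i.
Proof. by move=> lei; rewrite cons_seg nth_mkseq. Qed.

Lemma size_cons_seg p q : size (p :: seg p q) = (dist p q).+1.
Proof. by rewrite /= size_mkseq. Qed.

Lemma last_seg p q : axis p q -> last p (seg p q) = q.
Proof.
move=> pq; rewrite (last_nth o) size_mkseq nth_cons_seg //.
case/axisP: pq => n e -> ->; rewrite ?e //=.
- by rewrite addnK; case: q e.
- by rewrite addnK; case: q e.
Qed.

Lemma seg_gadj p q : axis p q -> path gadj p (seg p q).
Proof.
move=> pq; apply: (@introT _ _ (sortedP o (s := p :: seg p q))) => i.
rewrite size_cons_seg ltnS => lti; rewrite !nth_cons_seg ?(ltnW lti) //.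
case/axisP: pq => n e en pt; rewrite {}en in lti; rewrite !pt ?(ltnW lti) // /gadj ?e /=; lia.
Qed.

Lemma hedge_seg p q x y : axis p q ->
  hedge (p :: seg p q) x y =
    [&& p.2 == y, q.2 == y, minn p.1 q.1 <= x & x < maxn p.1 q.1].
Proof.
move=> pq; apply/idP/idP.
  case/orP => /(stepsP o)[i]; rewrite size_cons_seg ltnS => lti;
    rewrite !nth_cons_seg ?(ltnW lti) //;
  case/axisP: pq => n e en pt; rewrite {}en in lti; rewrite !pt ?(ltnW lti) // => -[];
  rewrite e /=; lia.
case/and4P => /eqP e1 /eqP e2 le1 lt2.
case/axisP: pq => n e en pt; rewrite e /= in e1 e2 le1 lt2; apply/orP; try lia.
- left; apply/(stepsP o); exists (x - p.1); rewrite ?size_cons_seg ?en; first by lia.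
  by rewrite !nth_cons_seg ?pt ?en /= ; try lia; congr (_, _, (_, _)); lia.
- right; apply/(stepsP o); exists (p.1 - x.+1); rewrite ?size_cons_seg ?en; first by rewrite e /=; lia.
  by rewrite !nth_cons_seg ?pt ?en e /= ; try lia; congr (_, _, (_, _)); lia.
Qed.


Lemma steps_cat (T : Type) (x : T) s t :
  steps (x :: s ++ t) = steps (x :: s) ++ steps (last x s :: t).
Proof. by elim: s x => [|y s IH] x //; rewrite /= -[RHS]/((x, y) :: _) -IH. Qed.

Lemma has_edge_cat p s t e :
  has_edge (p :: s ++ t) e = has_edge (p :: s) e || has_edge (last p s :: t) e.
Proof. by rewrite /has_edge steps_cat !mem_cat orbACA. Qed.

Lemma route_cons p q cs : route [:: p, q & cs] = p :: seg p q ++ trail q cs.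
Proof. by []. Qed.

(** Together with [vedge_route] this reduces questions about shared edges to linear arithmetic on
    corners. *)
Lemma hedge_route cs x y : sorted axis cs ->
  hedge (route cs) x y =
    has (fun e : gpoint * gpoint => [&& e.1.2 == y, e.2.2 == y,
      minn e.1.1 e.2.1 <= x & x < maxn e.1.1 e.2.1]) (steps cs).
Proof.
case: cs => // p cs; elim: cs p => // q cs IH p /= /andP[pq qcs].
by rewrite /hedge has_edge_cat last_seg // -/(hedge _ _ _) hedge_seg // -/(hedge _ _ _) IH.
Qed.

Lemma seg_flip p q : map flip (seg p q) = seg (flip p) (flip q).
Proof. by rewrite /seg /mkseq -map_comp /dist /= [in RHS]addnC. Qed.

Lemma route_flip cs : route (map flip cs) = map flip (route cs).
Proof.
case: cs => // p cs /=; congr cons.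
by elim: cs p => // q cs IH p /=; rewrite map_cat seg_flip IH.
Qed.

Lemma axis_flip cs : sorted axis (map flip cs) = sorted axis cs.
Proof. by rewrite sorted_map; apply: eq_sorted => p q; rewrite /= /axis addbC. Qed.

Lemma hedge_flip s x y : hedge (map flip s) x y = vedge s y x.
Proof.
pose f (e : gpoint * gpoint) := (flip e.1, flip e.2).
have f_inj : injective f by move=> [[a b] [c d]] [[a' b'] [c' d']] [-> -> -> ->].
rewrite /hedge /vedge /has_edge map_steps.
by congr (_ || _); rewrite -[in RHS](mem_map f_inj).
Qed.

Lemma vedge_route cs x y : sorted axis cs ->
  vedge (route cs) x y =
    has (fun e : gpoint * gpoint => [&& e.1.1 == x, e.2.1 == x,
      minn e.1.2 e.2.2 <= y & y < maxn e.1.2 e.2.2]) (steps cs).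
Proof.
by move=> cs_axis; rewrite -hedge_flip -route_flip hedge_route ?axis_flip // map_steps has_map.
Qed.

Lemma route_gadj cs : sorted axis cs -> sorted gadj (route cs).
Proof.
case: cs => // p cs; elim: cs p => // q cs IH p /= /andP[pq qcs].
by rewrite cat_path seg_gadj // last_seg //; apply: IH.
Qed.

Definition changes (u : seq bool) := count (fun e => e.1 != e.2) (steps u).

Lemma bends_changes s : bends s = changes (map horizontal (steps s)).
Proof. by rewrite /bends /changes map_steps count_map. Qed.

Lemma changes_cat u v : changes (u ++ v) <= changes u + 1 + changes v.
Proof.
case: u v => [|x u] [|y v]; rewrite ?cats0; try by rewrite /changes /=; lia.
rewrite /changes steps_cat count_cat -addnA leq_add2l -[steps _]/((last x u, y) :: steps (y :: v)) /=.
by rewrite leq_add2r; case: (_ != _).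
Qed.

Lemma changes_const b u : all (pred1 b) u -> changes u = 0.
Proof.
elim: u => [|x [|y u] IH] // /andP[/eqP-> /andP[/eqP ey ub]].
by rewrite -[changes _]/((b != y) + changes (y :: u)) {1}ey eqxx IH //= ey eqxx.
Qed.

Lemma bends_seg p q : axis p q -> bends (p :: seg p q) = 0.
Proof.
move=> pq; rewrite bends_changes; apply: (@changes_const (p.2 == q.2)).
apply/allP => _ /mapP[_ /(stepsP o)[i lti ->] ->]; move: lti.
rewrite size_cons_seg ltnS => lti; rewrite !nth_cons_seg ?(ltnW lti) //.
by case/axisP: pq => n e en pt; rewrite {}en in lti; rewrite !pt ?(ltnW lti) // /horizontal ?e /=; lia.
Qed.

(** Segments are straight, and joining two of them adds at most one change of direction, so bends
    occur only at inner corners. *)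
Lemma bends_route cs : sorted axis cs -> bends (route cs) <= (size cs).-2.
Proof.
case: cs => // p cs; elim: cs p => // q [|r cs] IH p /andP[pq qcs].
  by rewrite route_cons cats0 bends_seg.
rewrite route_cons bends_changes steps_cat map_cat last_seg //.
apply: leq_trans (changes_cat _ _) _; rewrite -!bends_changes bends_seg //.
by have := IH q qcs; rewrite /=; lia.
Qed.

(* Conditions on the corners under which a route is x-monotone, hence does not
   meet itself: no leftward segment, and each vertical one is followed by a
   rightward one. *)
Fixpoint rightward cs := if cs is p :: cs' then
  (if cs' is q :: cs'' then
    [&& axis p q, p.1 <= q.1 &
        (p.1 == q.1) ==> (if cs'' is r :: _ then q.1 < r.1 else true)]
  else true) && rightward cs' else true.

Lemma rightward_axis cs : rightward cs -> sorted axis cs.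
Proof. by elim: cs => [|p [|q cs] IH] //= /andP[/and3P[-> _ _] /IH]. Qed.

Lemma mem_cons_seg p q r : axis p q -> p.1 <= q.1 -> r \in p :: seg p q ->
  r.1 <= q.1 /\ (p.1 < q.1 -> r.1 = q.1 -> r = q).
Proof.
move=> pq lepq /(nthP o)[i]; rewrite size_cons_seg => lti.
rewrite nth_cons_seg ?(leq_trans lti) // => <-.
by case/axisP: pq => n e en pt; rewrite pt -?en // e /= in lepq *; split => //; try lia;
  move=> lt e1; congr pair; lia.
Qed.

Lemma mem_seg_fst p q r : axis p q -> p.1 <= q.1 -> r \in seg p q ->
  p.1 <= r.1 /\ (p.1 < q.1 -> p.1 < r.1).
Proof.
move=> pq lepq /(nthP o)[i]; rewrite size_mkseq => lti.
rewrite nth_mkseq // => <-.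
by case/axisP: pq => n e en pt; rewrite pt -?en // e /= in lepq *; split => //; lia.
Qed.

Lemma uniq_cons_seg p q : axis p q -> uniq (p :: seg p q).
Proof.
move=> pq; apply/(uniqP o) => i j; rewrite !inE size_cons_seg !ltnS => lei lej.
rewrite !nth_cons_seg //.
by case/axisP: pq => n e en pt; rewrite {}en in lei lej; rewrite !pt // ?e => -[] /=; lia.
Qed.

Lemma rightward_ge p cs r : rightward (p :: cs) -> r \in trail p cs -> p.1 <= r.1.
Proof.
elim: cs p => // q cs IH p /= /andP[/and3P[pq lepq _] qcs].
rewrite mem_cat => /orP[/(mem_seg_fst pq lepq)[]//|/IH-/(_ qcs)].
exact: leq_trans.
Qed.

Lemma rightward_gt p q cs r : rightward [:: p, q & cs] -> p.1 < q.1 ->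
  r \in trail p (q :: cs) -> p.1 < r.1.
Proof.
move=> /= /andP[/and3P[pq lepq _] qcs] ltpq.
rewrite mem_cat => /orP[/(mem_seg_fst pq lepq)[_ H]|/(rightward_ge qcs)]; first exact: H.
exact: leq_trans.
Qed.

(** The rest of the route never goes left of [q], so it can meet the first segment only in column
    [q.1]. A horizontal segment has only [q] there; after a vertical one the rest lies strictly to
    the right. *)
Lemma rightward_uniq cs : rightward cs -> uniq (route cs).
Proof.
case: cs => // p cs; elim: cs p => // q cs IH p pqcs.
have /andP[/and3P[pq lepq turn_right] qcs] := pqcs.
rewrite route_cons -cat_cons cat_uniq uniq_cons_seg //=.
have /= /andP[q_notin ->] := IH q qcs; rewrite andbT; apply/hasPn => r r_trail.
apply/negP => /(mem_cons_seg pq lepq)[ler rq].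
have [eqpq|neq] := eqVneq p.1 q.1; last first.
  have ltpq : p.1 < q.1 by rewrite ltn_neqAle neq.
  have er : r = q.
    by apply: rq ltpq _; apply/eqP; rewrite eqn_leq ler (rightward_ge qcs r_trail).
  by rewrite er (negbTE q_notin) in r_trail.
case: cs {IH pqcs} qcs q_notin r_trail turn_right => // s cs qcs _ r_trail.
rewrite eqpq eqxx => ltqs; have := rightward_gt qcs ltqs r_trail.
by rewrite ltnNge ler.
Qed.

Lemma route_gpath cs : 1 < size cs -> rightward cs -> gpath (route cs).
Proof.
move=> size_cs cs_right; have cs_axis := rightward_axis cs_right.
apply/and3P; split; [|exact: route_gadj|exact: rightward_uniq].
case: cs size_cs cs_axis {cs_right} => // p [|q cs] // _ /andP[pq _] /=.
by rewrite size_cat size_mkseq; case/axisP: pq => n _ -> _.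
Qed.

End Routes.

Lemma gpath_flip s : gpath (map flip s) = gpath s.
Proof.
rewrite /gpath size_map (map_inj_uniq (can_inj flipK)) sorted_map.
by congr [&& _, _ & _]; apply: eq_sorted => p q; rewrite /= /gadj /= orbC.
Qed.

Lemma bends_flip s : gpath s -> bends (map flip s) = bends s.
Proof.
case/and3P => _ gs _; rewrite !bends_changes map_steps -map_comp.
have -> : [seq (horizontal \o (fun e : gpoint * gpoint => (flip e.1, flip e.2))) i | i <- steps s] =
    map negb (map horizontal (steps s)).
  rewrite -[RHS]map_comp; apply/eq_in_map => _ /(stepsP o)[i lti ->] /=.
  have /(sortedP o)/(_ _ lti) := gs; rewrite /gadj /horizontal /=.
  by case: (nth o s i) => x y; case: (nth o s i.+1) => x' y' /=; lia.
by rewrite /changes map_steps count_map; apply: eq_count => -[[] []].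
Qed.

Lemma vedge_flip s x y : vedge (map flip s) x y = hedge s y x.
Proof. by rewrite -[in RHS](mapK flipK s) hedge_flip. Qed.

Lemma hedge_rows cs x y : sorted axis cs -> hedge (route cs) x y -> exists x', (x', y) \in cs.
Proof.
move=> cs_axis; rewrite hedge_route // => /hasP[e /(stepsP o)[i lti ->]] /=.
case/and3P => /eqP ey _ _; exists (nth o cs i).1.
by rewrite -{}ey -surjective_pairing mem_nth // ltnW.
Qed.

Lemma vedge_columns cs x y : sorted axis cs -> vedge (route cs) x y -> exists y', (x, y') \in cs.
Proof.
move=> cs_axis; rewrite vedge_route // => /hasP[e /(stepsP o)[i lti ->]] /=.
case/and3P => /eqP ex _ _; exists (nth o cs i).2.
by rewrite -{}ex -surjective_pairing mem_nth // ltnW.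
Qed.

(** * Serpentines and stairs *)

Section Zigzag.

Variables (X : nat -> nat) (lo hi : nat).
Hypothesis X_lt : forall v, X v < X v.+1.
Hypothesis lo_lt_hi : lo < hi.

Let Y (up : bool) := if up then hi else lo.

(** Even vertical segments go up and odd ones down, so each ends in the row where the next
    begins. *)
Fixpoint zigzag v n : seq gpoint :=
  if n is n'.+1 then [:: (X v, Y (odd v)), (X v, Y (~~ odd v)) & zigzag v.+1 n'] else [::].

Lemma size_zigzag v n : size (zigzag v n) = n.*2.
Proof. by elim: n v => //= n IH v; rewrite IH. Qed.

Lemma zigzag_rightward v n : rightward (zigzag v n).
Proof.
have XS := X_lt; elim: n v => // -[|n] IH v /=.
  by rewrite /axis /= leqnn eqxx implybT /Y; case: (odd v) => /=; lia.
move: {IH} (IH v.+1) => /= ->.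
have := X_lt v; have := X_lt v.+1; rewrite /axis /Y /=; case: (odd v) => /=; lia.
Qed.

Lemma mem_zigzag v n x y : (x, y) \in zigzag v n ->
  (exists2 w, v <= w < v + n & x = X w) /\ (y = lo \/ y = hi).
Proof.
clear X_lt lo_lt_hi; have Ylh b : Y b = lo \/ Y b = hi by rewrite /Y; case: b; [right|left].
elim: n v => // n IH v; rewrite /= !inE => /or3P[/eqP[-> ->]|/eqP[-> ->]|/IH[[w vw ->] yY]]; split=> //.
- by exists v => //; lia.
- by exists v => //; lia.
- by exists w => //; lia.
Qed.

Lemma vedge_zigzag v n w y : v <= w < v + n -> lo <= y < hi -> vedge (route (zigzag v n)) (X w) y.
Proof.
move=> vw yY; rewrite vedge_route ?rightward_axis ?zigzag_rightward //; apply/hasP.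
exists ((X w, Y (odd w)), (X w, Y (~~ odd w))); last by rewrite /= !eqxx /Y; case: (odd w) => /=; lia.
elim: n v vw => [|n IH] v vw; first by lia.
have [->|neq] := eqVneq w v; first by rewrite inE eqxx.
have /IH : v.+1 <= w < v.+1 + n by lia.
rewrite /steps /= => in_steps; rewrite inE; apply/orP; right.
by case: (zigzag _ _) in_steps => //= a l; rewrite inE orbC => ->.
Qed.

End Zigzag.

Definition stair x y n : seq gpoint := mkseq (fun t => (x + uphalf t, y + t./2)) n.+1.

Lemma stair_gpath x y n : 0 < n -> gpath (stair x y n).
Proof.
move=> n_gt0; apply/and3P; split; first by rewrite size_mkseq ltnS.
  apply/(sortedP o) => i; rewrite size_mkseq => lti; rewrite !nth_mkseq ?(ltnW lti) //.
  by rewrite /gadj /=; lia.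
by rewrite map_inj_uniq ?iota_uniq // => i j []; lia.
Qed.

Lemma stair_bends x y n : bends (stair x y n) <= n.-1.
Proof.
by rewrite /bends (leq_trans (count_size _ _)) // !size_steps size_mkseq.
Qed.

Lemma hedge_stair x y n a b :
  reflect (exists2 u, u.*2 < n & a = x + u /\ b = y + u) (hedge (stair x y n) a b).
Proof.
apply: (iffP orP) => [[]|[u ltu [-> ->]]].
- move=> /(stepsP o)[i]; rewrite size_mkseq => lti; rewrite !nth_mkseq ?(ltnW lti) // => -[].
  by exists i./2; lia.
- move=> /(stepsP o)[i]; rewrite size_mkseq => lti; rewrite !nth_mkseq ?(ltnW lti) // => -[].
  by lia.
left; apply/(stepsP o); exists u.*2; rewrite ?size_mkseq //.
by rewrite !nth_mkseq; [congr (_, _, (_, _)); lia | lia..].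
Qed.

Lemma vedge_stair x y n a b :
  reflect (exists2 u, u.*2.+1 < n & a = x + u.+1 /\ b = y + u) (vedge (stair x y n) a b).
Proof.
apply: (iffP orP) => [[]|[u ltu [-> ->]]].
- move=> /(stepsP o)[i]; rewrite size_mkseq => lti; rewrite !nth_mkseq ?(ltnW lti) // => -[].
  by exists i./2; lia.
- move=> /(stepsP o)[i]; rewrite size_mkseq => lti; rewrite !nth_mkseq ?(ltnW lti) // => -[].
  by lia.
left; apply/(stepsP o); exists u.*2.+1; rewrite ?size_mkseq //.
by rewrite !nth_mkseq; [congr (_, _, (_, _)); lia | lia..].
Qed.

(** * Separation for [k >= 4] *)

(* The lines (true, i) are serpentines with V long vertical segments, in the
   unit-spaced columns M + vM + i; the lines (false, i) are their transposes.
   Every edge of the central VM x VM grid lies on one of the lines, and the path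
   (g, r) is a staircase in this grid that bends at each of its inner points. *)
Section Grid.

Variables k M : nat.
Hypothesis k_gt0 : 0 < k.
Hypothesis k_lt_M : k < M.

(** A serpentine with [V] vertical segments has [V.*2] corners and thus [V.*2 - 2] bends; this is
    the largest [V] that [k] bends permit. *)
Let V := k./2.+1.

Let M_gt0 : 0 < M. Proof. exact: leq_ltn_trans k_lt_M. Qed.

(** The residue modulo [M] identifies the line, the quotient its segment. The shift by [M] separates
    the central grid from the connecting rows [i < M]. *)
Definition column i v := M + v * M + i.

Let column_lt i v : column i v < column i v.+1.
Proof. by rewrite /column mulSn; lia. Qed.

Let rung (i : 'I_M) := zigzag (column i) i (M + V * M + i) 0 V.

Let rung_lt i : i < M + V * M + i.
Proof. by have := M_gt0; lia. Qed.

Definition grid_line (a : bool * 'I_M) : seq gpoint :=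
  let s := route (rung a.2) in if a.1 then s else map flip s.

(** Starting columns are [V] apart, so the column of an edge determines [b.1] and its row then
    [b.2]. The index ranges keep every stair inside the central grid. *)
Definition grid_stair (b : 'I_M.-1 * 'I_(V * M.-1)) : seq gpoint :=
  stair (M + V * b.1) (M + b.2) k.+1.

Definition grid_path (v : (bool * 'I_M) + ('I_M.-1 * 'I_(V * M.-1))) :=
  match v with inl a => grid_line a | inr b => grid_stair b end.

Let rung_rightward i : rightward (rung i).
Proof. exact: zigzag_rightward (column_lt i) (rung_lt i) _ _. Qed.

Let rung_gpath i : gpath (route (rung i)).
Proof. by apply: route_gpath => //; rewrite size_zigzag. Qed.

Lemma grid_path_gpath v : gpath (grid_path v).
Proof.
case: v => [[[] i]|b] /=; [exact: rung_gpath| |exact: stair_gpath].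
by rewrite gpath_flip rung_gpath.
Qed.

Lemma grid_path_bends v : bends (grid_path v) <= k.
Proof.
have rung_bends i : bends (route (rung i)) <= k.
  apply: leq_trans (bends_route (rightward_axis (rung_rightward i))) _.
  by rewrite size_zigzag /V; lia.
case: v => [[[] i]|b] /=; first exact: rung_bends.
  by rewrite bends_flip ?rung_gpath ?rung_bends.
exact: stair_bends.
Qed.

Let rung_vedge i x y : vedge (route (rung i)) x y -> exists2 v, v < V & x = column i v.
Proof.
case/(vedge_columns (rightward_axis (rung_rightward i))) => y' /mem_zigzag.
by case=> -[v vV ->] _; exists v.
Qed.

Let rung_hedge i x y : hedge (route (rung i)) x y -> y = i \/ y = M + V * M + i.
Proof. by case/(hedge_rows (rightward_axis (rung_rightward i))) => x' /mem_zigzag[_]. Qed.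

Let column_bounds (i : 'I_M) v : v < V -> M <= column i v < M + V * M.
Proof.
move=> ltv; have := ltn_ord i; have : v.+1 * M <= V * M by rewrite leq_mul2r ltv orbT.
by rewrite mulSn /column; lia.
Qed.

Let column_inj (i i' : 'I_M) v v' : column i v = column i' v' -> i = i'.
Proof.
move/(congr1 (modn^~ M)); rewrite /column -!addnA !modnDl !modnMDl !modn_small //.
exact: val_inj.
Qed.

Let hedge_line a x y : hedge (grid_line a) x y =
  if a.1 then hedge (route (rung a.2)) x y else vedge (route (rung a.2)) y x.
Proof. by case: a => -[] i //; rewrite hedge_flip. Qed.

Let vedge_line a x y : vedge (grid_line a) x y =
  if a.1 then vedge (route (rung a.2)) x y else hedge (route (rung a.2)) y x.
Proof. by case: a => -[] i //; rewrite vedge_flip. Qed.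

(** Lines of one type differ in the residues of their long segments and in their connecting rows.
    Lines of different types meet only in points, since connections stay outside the central range
    and long segments inside. *)
Lemma grid_line_indep a a' : a != a' -> ~~ share_edge (grid_line a) (grid_line a').
Proof.
move=> neq; apply/negP => /share_edgeE[|x [y]].
  by apply/gpath_sorted; rewrite (grid_path_gpath (inl a)).
have vv i i' y1 y2 x1 : vedge (route (rung i)) x1 y1 -> vedge (route (rung i')) x1 y2 -> i = i'.
  by move=> /rung_vedge[v _ ->] /rung_vedge[v' _] /column_inj.
have hh i i' x1 x2 y1 : hedge (route (rung i)) x1 y1 -> hedge (route (rung i')) x2 y1 -> i = i'.
  move=> /rung_hedge yi /rung_hedge yi'; apply: val_inj => /=.
  by have := ltn_ord i; have := ltn_ord i'; lia.
have hv i i' x1 x2 y1 : hedge (route (rung i)) x1 y1 -> vedge (route (rung i')) y1 x2 -> False.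
  move=> /rung_hedge yi /rung_vedge[v /(column_bounds i') lev ey].
  by have := ltn_ord i; lia.
rewrite !hedge_line !vedge_line.
case: a a' neq => [[] i] [[] i'] neq /orP[] /andP[].
- by move=> h1 h2; case/eqP: neq; rewrite (hh i i' _ _ _ h1 h2).
- by move=> h1 h2; case/eqP: neq; rewrite (vv i i' _ _ _ h1 h2).
- exact: hv.
- by move=> h1 h2; apply: hv h2 h1.
- by move=> h1 h2; apply: hv h2 h1.
- exact: hv.
- by move=> h1 h2; case/eqP: neq; rewrite (vv i i' _ _ _ h1 h2).
- by move=> h1 h2; case/eqP: neq; rewrite (hh i i' _ _ _ h1 h2).
Qed.

Lemma grid_stair_indep b b' : b != b' -> ~~ share_edge (grid_stair b) (grid_stair b').
Proof.
move=> neq; apply/negP => /share_edgeE[|x [y]].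
  by apply/gpath_sorted; rewrite (grid_path_gpath (inr b)).
case: b b' neq => g r [g' r']; rewrite /grid_stair /= => neq.
have same u u' : u < V -> u' < V -> V * g + u = V * g' + u' -> r + u = r' + u' -> False.
  move=> ltu ltu' eqg eqr; have eg : g = g' :> nat.
    have := congr1 (divn^~ V) eqg; rewrite !(mulnC V) !divnMDl // !divn_small //.
    by rewrite !addn0.
  have er : r = r' :> nat by rewrite eg in eqg; lia.
  by rewrite (val_inj eg) (val_inj er) eqxx in neq.
case/orP => /andP[].
  move=> /hedge_stair[u ltu [-> ->]] /hedge_stair[u' ltu' [e e']].
  by apply: (@same u u'); rewrite /V in e e' *; lia.
move=> /vedge_stair[u ltu [-> ->]] /vedge_stair[u' ltu' [e e']].
by apply: (@same u u'); rewrite /V in e e' *; lia.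
Qed.

Definition residue n : 'I_M := Ordinal (ltn_pmod n M_gt0).

(** Edge [t] of a stair is vertical for odd [t] and horizontal for even [t]; the residue of its
    column or row gives the line that contains it. *)
Definition crossed (b : 'I_M.-1 * 'I_(V * M.-1)) (t : 'I_k.+1) : bool * 'I_M :=
  (odd t, residue (if odd t then V * b.1 + uphalf t else b.2 + t./2)).

(** Offsets up to [k < M] stay distinct modulo [M], so the [k.+1] edges of a stair lie on distinct
    lines. *)
Lemma residue_inj c u u' : u <= k -> u' <= k -> residue (c + u) = residue (c + u') -> u = u'.
Proof.
move=> leu leu' /(congr1 val) /= /eqP; rewrite eqn_modDl !modn_small; last 2 first.
- exact: leq_ltn_trans k_lt_M.
- exact: leq_ltn_trans k_lt_M.
by move/eqP.
Qed.

Lemma crossed_inj b : injective (crossed b).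
Proof.
move=> t t' eqc; have /= et := congr1 fst eqc; have {eqc} /= eqr := congr1 snd eqc.
have := ltn_ord t; have := ltn_ord t'; move: eqr; rewrite et.
case: ifP => ot' /residue_inj eqr ltt' ltt; apply: val_inj => /=.
  by have : uphalf t = uphalf t' by [apply: eqr; lia]; lia.
by have : t./2 = t'./2 by [apply: eqr; lia]; lia.
Qed.

Let rung_vedge_mem (i : 'I_M) v y : v < V -> M <= y < M + V * M -> vedge (route (rung i)) (column i v) y.
Proof.
move=> ltv le_y; apply: vedge_zigzag => //.
by have := ltn_ord i; lia.
Qed.

Let column_residue n : column (residue n) (n %/ M) = M + n.
Proof. by rewrite /column /= -addnA -divn_eq. Qed.

Lemma crossed_share b t : share_edge (grid_line (crossed b t)) (grid_stair b).
Proof.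
have gl : sorted gadj (grid_line (crossed b t)).
  by apply/gpath_sorted; rewrite (grid_path_gpath (inl (crossed b t))).
case: b gl => g r gl; have := ltn_ord g; have := ltn_ord r; have := ltn_ord t => lt_t lt_r lt_g.
have V_gt0 : 0 < V by [].
have Vg : V * g + V <= V * M.-1 by rewrite -mulnSr leq_mul2l; lia.
have VM : V * M = V * M.-1 + V by rewrite -mulnSr prednK.
have div_lt n : n < V * M -> n %/ M < V by rewrite ltn_divLR.
have tV : uphalf t <= V by rewrite /V; lia.
have tV' : t./2 < V by rewrite /V; lia.
have r_row : r + t./2 < V * M by rewrite VM -addnS leq_add // ltnW.
have g_column : V * g + uphalf t < V * M.
  by apply: leq_ltn_trans (_ : V * g + V < _); rewrite ?leq_add2l // VM -addn1 leq_add.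
have g_row : V * g + t./2 < V * M.
  by rewrite VM -addnS leq_add // (leq_trans _ Vg) // leq_addr.
have rung_residue n y : n < V * M -> M <= y < M + V * M ->
    vedge (route (rung (residue n))) (M + n) y.
  by move=> /div_lt ltn ley; rewrite -column_residue; apply: rung_vedge_mem.
case: (boolP (odd t)) => ot; rewrite /crossed ?ot ?(negbTE ot) in gl *.
  apply: (share_vedge (x := M + (V * g + uphalf t)) (y := M + r + t./2)) => //.
    by rewrite vedge_line; apply: rung_residue; rewrite // -addnA leq_addr ltn_add2l.
  have e : uphalf t = t./2.+1 by lia.
  by apply/vedge_stair; exists t./2; [lia | rewrite e !addnA].
apply: (share_hedge (x := M + V * g + t./2) (y := M + (r + t./2))) => //.
  by rewrite hedge_line; apply: rung_residue; rewrite // -addnA leq_addr ltn_add2l.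
by apply/hedge_stair; exists t./2; [lia | rewrite !addnA].
Qed.

(** Lines of opposite type form any pair. Lines of the same type on a common stair have indices
    differing by at most [k] modulo [M], so these pairs are only linearly many in [M]. The code [d]
    is the difference plus [k], and [M - k] undoes this shift modulo [M]. *)
Let pair_of (c : bool * ('I_M * 'I_M) + bool * ('I_M * 'I_k.*2.+1)) :=
  match c with
  | inl (f, (i, j)) => ((f, i), (~~ f, j))
  | inr (f, (i, d)) => ((f, i), (f, residue (i + d + (M - k))))
  end.

Definition near_pairs := pair_of @: [set: _].

Lemma card_near_pairs : #|near_pairs| <= 2 * M * M + 2 * M * k.*2.+1.
Proof.
apply: leq_trans (leq_imset_card _ _) _.
by rewrite cardsT ?card_sum !card_prod card_bool !card_ord; lia.
Qed.

Lemma crossed_near b t t' : (crossed b t, crossed b t') \in near_pairs.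
Proof.
rewrite /crossed; have := ltn_ord t; have := ltn_ord t' => ltt ltt'.
have near f c u u' : u <= k -> u' <= k ->
    ((f, residue (c + u)), (f, residue (c + u'))) \in near_pairs.
  move=> leu leu'; have ltd : u' + k - u < k.*2.+1 by lia.
  apply/imsetP; exists (inr (f, (residue (c + u), Ordinal ltd))) => //=.
  congr (_, (_, _)); apply: val_inj => /=.
  rewrite -addnA modnDml.
  have -> : c + u + (u' + k - u + (M - k)) = c + u' + M by have := k_lt_M; lia.
  by rewrite modnDr.
have [et|neq] := eqVneq (odd t) (odd t').
  by rewrite et; case: ifP => _; apply: near; lia.
have -> : odd t' = ~~ odd t by case: (odd t) (odd t') neq => [] [].
by apply/imsetP; exists (inl (odd t, (residue (if odd t then V * b.1 + uphalf t else b.2 + t./2),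
   residue (if ~~ odd t then V * b.1 + uphalf t' else b.2 + t'./2)))).
Qed.

(** Here [m = k.+1]: of the [2 * k] needed by each stair its own bends cover [k], and [k] savings
    remain. *)
Lemma grid_not_monotonic : Bm k (intersection_graph grid_path) ->
  M.-1 * (V * M.-1) * k <= k.+1 * (2 * M * M + 2 * M * k.*2.+1 + 4 * M).
Proof.
move=> monotone; have := @monotonic_count _ _ k k.+1 grid_path crossed near_pairs
  grid_line_indep grid_stair_indep crossed_inj crossed_share
  (fun b t t' _ => crossed_near b t t') monotone.
rewrite !card_prod card_bool !card_ord /= mulnCA mul2n -addnn [k * _]mulnC leq_add2l.
move=> count; apply: leq_trans count _; rewrite leq_mul2l /=.
by rewrite addnC mulnA leq_add2r card_near_pairs.
Qed.

End Grid.

Lemma proper_subclass_ge4 k : 4 <= k -> proper_subclass (Bm k) (B k).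
Proof.
move=> k_ge4; split; first exact: Bm_sub_B.
(* [2 * k * V] is the linear loss in [k * V * M.-1 ^ 2], and [k.+1 * (4 * k + 6)] is the linear
   coefficient on the other side; beyond their sum the quadratic terms decide. *)
set V := k./2.+1; set M := 2 * k * V + k.+1 * (4 * k + 6) + 1.
have k_gt0 : 0 < k by lia.
have k_lt_M : k < M by rewrite /M /V; nia.
exists (intersection_graph (grid_path (k := k) (M := M))); split.
  by apply: intersection_graph_B; [apply: grid_path_gpath | apply: grid_path_bends].
move=> /(grid_not_monotonic k_gt0 k_lt_M); apply/negP; rewrite -ltnNge -/V.
(* The comparison of the coefficients of [M ^ 2]; it fails for [k = 3], where it would read
   [8 < 6]. *)
have Z : 2 * k.+1 < k * V by rewrite /V; nia.
have [M1 eM] : exists M1, M = M1.+1 by exists M.-1; rewrite /M; lia.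
have M1e : M1 = 2 * k * V + k.+1 * (4 * k + 6) by rewrite /M in eM; lia.
rewrite eM /= -mul2n; clear eM; nia.
Qed.

(** * Separation for [k = 3] *)

Lemma route_gpath_upward cs : 1 < size cs -> rightward (map flip cs) -> gpath (route cs).
Proof.
move=> size_cs up; rewrite -gpath_flip -route_flip; apply: route_gpath => //.
by rewrite size_map.
Qed.

(** The spacing leaves room for a unit edge of a hook on either side of each column. *)
Definition xcol c := 30 + 3 * c.
Definition yrow r := 130 * r.+1.

(* With 3 bends the lines [Some (true, i)] (two long vertical segments, then a
   horizontal tail) and [Some (false, j)] (a vertical tail, then two long
   horizontal segments) cross 5 times, one more than ascending paths can.  [None]
   is a frame around all of them, reached by every hook on a row of its own:
   130 > 2 * 60 leaves room for 60 private rows on both sides of each [yrow]. *)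
Definition line_corners (a : option (bool * 'I_20)) : seq gpoint :=
  match a with
  | Some (true, i) =>
      [:: (xcol i, 40 + i); (xcol i, 130 * 62 + i); (xcol (20 + i), 130 * 62 + i);
          (xcol (20 + i), yrow i); (400 + i, yrow i)]
  | Some (false, j) =>
      [:: (xcol (40 + j), 10 + j); (xcol (40 + j), yrow (20 + j)); (1 + j, yrow (20 + j));
          (1 + j, yrow (40 + j)); (300 + j, yrow (40 + j))]
  | None => [:: (0, 0); (0, 130 * 63); (500, 130 * 63); (500, 1)]
  end.

(** The two hooks divide the four edges at a crossing: one takes the left and upper edge, the other
    the lower and right one. Both bend there without sharing an edge. *)
Definition hook_corners (up : bool) c r : seq gpoint :=
  if up then
    [:: (29 + 3 * c, yrow r); (xcol c, yrow r); (xcol c, yrow r + c.+1);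
        (500, yrow r + c.+1); (500, yrow r + c.+2)]
  else
    [:: (0, yrow r - c.+2); (0, yrow r - c.+1); (xcol c, yrow r - c.+1);
        (xcol c, yrow r); (31 + 3 * c, yrow r)].

Lemma line_axis a : sorted axis (line_corners a).
Proof.
by case: a => [[[] i]|] //; rewrite /= /axis /= /xcol /yrow; have := ltn_ord i; lia.
Qed.

Lemma line_gpath a : gpath (route (line_corners a)).
Proof.
case: a => [[[] i]|].
- by apply: route_gpath => //; rewrite /= /axis /= /xcol /yrow; have := ltn_ord i; lia.
- by apply: route_gpath_upward => //; rewrite /= /axis /= /xcol /yrow; have := ltn_ord i; lia.
- exact: route_gpath.
Qed.

Lemma hook_rightward up c r : c < 60 -> rightward (hook_corners up c r).
Proof. by move=> c60; case: up; rewrite /= /axis /= /xcol /yrow; lia. Qed.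

Lemma hook_hedge up c r x y : c < 60 -> hedge (route (hook_corners up c r)) x y ->
  if up then y = yrow r /\ x = 29 + 3 * c \/ y = yrow r + c.+1
  else y = yrow r /\ x = xcol c \/ y = yrow r - c.+1.
Proof.
move=> c60; rewrite hedge_route ?(rightward_axis (hook_rightward _ _ c60)) //.
by case: up; rewrite /= /xcol /yrow; lia.
Qed.

Lemma hook_vedge up c r x y : c < 60 -> vedge (route (hook_corners up c r)) x y ->
  if up then x = xcol c /\ yrow r <= y < yrow r + c.+1 \/ x = 500 /\ y = yrow r + c.+1
  else x = xcol c /\ yrow r - c.+1 <= y < yrow r \/ x = 0 /\ y = yrow r - c.+2.
Proof.
move=> c60; rewrite vedge_route ?(rightward_axis (hook_rightward _ _ c60)) //.
by case: up; rewrite /= /xcol /yrow; lia.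
Qed.

(** The multiple of 130 nearest to a shared edge gives [r], its offset or its column gives [c], and
    its side of the crossing gives [up]. *)
Lemma hook_indep up c r up' c' r' : c < 60 -> r < 60 -> c' < 60 -> r' < 60 ->
  share_edge (route (hook_corners up c r)) (route (hook_corners up' c' r')) ->
  [/\ up = up', c = c' & r = r'].
Proof.
move=> c60 r60 c60' r60' /share_edgeE[|x [y]].
  by apply: route_gadj; apply: rightward_axis; apply: hook_rightward.
case/orP => /andP[].
  move=> /(hook_hedge c60) h /(hook_hedge c60') h'.
  by case: up up' h h' => [] []; rewrite /xcol /yrow => h h'; split=> //; lia.
move=> /(hook_vedge c60) h /(hook_vedge c60') h'.
by case: up up' h h' => [] []; rewrite /xcol /yrow => h h'; split=> //; lia.
Qed.

Lemma line_hedge a x y : hedge (route (line_corners a)) x y ->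
  match a with
  | Some (true, i) => y = 130 * 62 + i \/ y = yrow i
  | Some (false, j) => y = yrow (20 + j) \/ y = yrow (40 + j)
  | None => y = 130 * 63
  end.
Proof. by rewrite hedge_route ?line_axis //; case: a => [[[] i]|]; rewrite /=; lia. Qed.

Lemma line_vedge a x y : vedge (route (line_corners a)) x y ->
  match a with
  | Some (true, i) => x = xcol i \/ x = xcol (20 + i)
  | Some (false, j) => x = xcol (40 + j) \/ x = 1 + j
  | None => x = 0 \/ x = 500
  end.
Proof. by rewrite vedge_route ?line_axis //; case: a => [[[] i]|]; rewrite /=; lia. Qed.

Lemma line_indep a a' : a != a' ->
  ~~ share_edge (route (line_corners a)) (route (line_corners a')).
Proof.
move=> /eqP neq; apply/negP => /share_edgeE[|x [y]]; first exact/route_gadj/line_axis.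
have case_i i i' (f : bool) : Some (f, i) <> Some (f, i') :> option (bool * 'I_20) ->
    i <> i' :> nat by move=> ne ei; apply: ne; rewrite (val_inj ei).
case/orP => /andP[].
  move=> /line_hedge h /line_hedge; move: a a' neq h => [[[] i]|] [[[] i']|] neq;
  rewrite /= /yrow; try (by case: neq); try (have {neq} := case_i _ _ _ neq);
  try have := ltn_ord i; try have := ltn_ord i'; lia.
move=> /line_vedge h /line_vedge; move: a a' neq h => [[[] i]|] [[[] i']|] neq;
  rewrite /= /xcol; try (by case: neq); try (have {neq} := case_i _ _ _ neq);
  try have := ltn_ord i; try have := ltn_ord i'; lia.
Qed.

(* (i, j, q, up) encodes one of the two paths bending at the q-th crossing of
   the lines [Some (true, i)] and [Some (false, j)]: for q < 4 the crossings of
   their long segments, for q = 4 the crossing of their final segments. *)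
Definition hook := ('I_20 * 'I_20 * 'I_5 * bool)%type.

Definition hook_column (i j q : nat) :=
  if q == 4 then 40 + j else if odd q then 20 + i else i.
Definition hook_row (i j q : nat) :=
  if q == 4 then i else if q < 2 then 20 + j else 40 + j.

Definition three_path (v : option (bool * 'I_20) + hook) :=
  match v with
  | inl a => route (line_corners a)
  | inr (i, j, q, up) => route (hook_corners up (hook_column i j q) (hook_row i j q))
  end.

Lemma hook_bounds (i j : 'I_20) q : hook_column i j q < 60 /\ hook_row i j q < 60.
Proof.
have := ltn_ord i; have := ltn_ord j; rewrite /hook_column /hook_row.
by repeat case: ifP => _; split; lia.
Qed.

Lemma three_gpath v : gpath (three_path v).
Proof.
case: v => [a|[[[i j] q] up]] /=; first exact: line_gpath.
have [c60 _] := hook_bounds i j q; apply: route_gpath; last exact: hook_rightward.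
by case: up.
Qed.

Lemma three_bends v : bends (three_path v) <= 3.
Proof.
case: v => [a|[[[i j] q] up]].
  by apply: leq_trans (bends_route (line_axis a)) _; case: a => [[[] i]|].
have [c60 _] := hook_bounds i j q.
by apply: leq_trans (bends_route (rightward_axis (hook_rightward _ _ c60))) _; case: up.
Qed.

(** The blocks of 20 that contain the column and the row determine [q]; the positions inside these
    blocks are [i] and [j]. *)
Lemma hook_inj (i j i' j' : 'I_20) (q q' : 'I_5) :
  hook_column i j q = hook_column i' j' q' -> hook_row i j q = hook_row i' j' q' ->
  [/\ i = i', j = j' & q = q'].
Proof.
have := ltn_ord i; have := ltn_ord j; have := ltn_ord i'; have := ltn_ord j'.
have := ltn_ord q; have := ltn_ord q' => q5' q5 j20' i20' j20 i20.
rewrite /hook_column /hook_row => ec er.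
have [ei ej eq] : [/\ i = i' :> nat, j = j' :> nat & q = q' :> nat].
  by move: ec er; repeat case: ifP => ?; split; lia.
by split; apply: val_inj.
Qed.

Lemma three_hook_indep (b b' : hook) : b != b' ->
  ~~ share_edge (three_path (inr b)) (three_path (inr b')).
Proof.
case: b b' => [[[i j] q] up] [[[i' j'] q'] up'] /eqP neq; apply/negP => share.
have [c60 r60] := hook_bounds i j q; have [c60' r60'] := hook_bounds i' j' q'.
have [eup ec er] := hook_indep c60 r60 c60' r60' share.
by have [ei ej eq] := hook_inj ec er; apply: neq; rewrite eup ei ej eq.
Qed.

(** The list has two entries, so [t = 2] yields the default [None], which is the frame. *)
Definition hook_line (b : hook) (t : 'I_3) : option (bool * 'I_20) :=
  nth None [:: Some (true, b.1.1.1); Some (false, b.1.1.2)] t.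

Lemma hook_line_inj b : injective (hook_line b).
Proof.
case: b => [[[i j] q] up] [[|[|[|t]]] ?] [[|[|[|t']]] ?] //= _; exact: val_inj.
Qed.

Lemma hook_vedge_column up c r : c < 60 ->
  vedge (route (hook_corners up c r)) (xcol c) (if up then yrow r else (yrow r).-1).
Proof.
move=> c60; rewrite vedge_route ?(rightward_axis (hook_rightward _ _ c60)) //.
by case: up; rewrite /= /xcol /yrow; lia.
Qed.

Lemma hook_hedge_row up c r : c < 60 ->
  hedge (route (hook_corners up c r)) (if up then 29 + 3 * c else xcol c) (yrow r).
Proof.
move=> c60; rewrite hedge_route ?(rightward_axis (hook_rightward _ _ c60)) //.
by case: up; rewrite /= /xcol /yrow; lia.
Qed.

Lemma hook_vedge_end up c r : c < 60 ->
  vedge (route (hook_corners up c r)) (if up then 500 else 0)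
    (if up then yrow r + c.+1 else yrow r - c.+2).
Proof.
move=> c60; rewrite vedge_route ?(rightward_axis (hook_rightward _ _ c60)) //.
by case: up; rewrite /= /xcol /yrow; lia.
Qed.

Lemma hook_share a up c r (x := if up then 29 + 3 * c else xcol c)
    (y := if up then yrow r else (yrow r).-1) : c < 60 ->
  [|| vedge (route (line_corners a)) (xcol c) y, hedge (route (line_corners a)) x (yrow r) |
      vedge (route (line_corners a)) (if up then 500 else 0)
        (if up then yrow r + c.+1 else yrow r - c.+2)] ->
  share_edge (route (line_corners a)) (route (hook_corners up c r)).
Proof.
move=> c60; have gl := route_gadj (line_axis a).
case/or3P => h; [apply: share_vedge gl h _ | apply: share_hedge gl h _ | apply: share_vedge gl h _].
- exact: hook_vedge_column.
- exact: hook_hedge_row.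
- exact: hook_vedge_end.
Qed.

Lemma column_line_vedge (i : 'I_20) (c y : nat) : c = i \/ c = 20 + i -> yrow i <= y -> 60 <= y < 130 * 62 ->
  vedge (route (line_corners (Some (true, i)))) (xcol c) y.
Proof.
by move=> ci; rewrite vedge_route ?line_axis //= /xcol /yrow; have := ltn_ord i; lia.
Qed.

Lemma column_line_tail (i : 'I_20) x : xcol 39 <= x < 400 ->
  hedge (route (line_corners (Some (true, i)))) x (yrow i).
Proof.
by rewrite hedge_route ?line_axis //= /xcol /yrow; have := ltn_ord i; lia.
Qed.

Lemma row_line_hedge (j : 'I_20) (r x : nat) : r = 20 + j \/ r = 40 + j -> 21 <= x < xcol 40 ->
  hedge (route (line_corners (Some (false, j)))) x (yrow r).
Proof.
by move=> rj; rewrite hedge_route ?line_axis //= /xcol /yrow; have := ltn_ord j; lia.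
Qed.

Lemma row_line_tail (j : 'I_20) y : 30 <= y < yrow 20 ->
  vedge (route (line_corners (Some (false, j)))) (xcol (40 + j)) y.
Proof.
by rewrite vedge_route ?line_axis //= /xcol /yrow; have := ltn_ord j; lia.
Qed.

Lemma frame_vedge (right : bool) y : 0 < y < 130 * 63 ->
  vedge (route (line_corners None)) (if right then 500 else 0) y.
Proof. by rewrite vedge_route ?line_axis //=; case: right; lia. Qed.

Lemma hook_share_lines (i j : 'I_20) q up
    (meets := fun a => share_edge (route (line_corners a))
       (route (hook_corners up (hook_column i j q) (hook_row i j q)))) :
  [/\ meets (Some (true, i)), meets (Some (false, j)) & meets None].
Proof.
have [c60 r60] := hook_bounds i j q; move: (ltn_ord i) (ltn_ord j) => i20 j20.
split; apply: (hook_share c60); apply/or3P; clear meets.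
- rewrite /hook_column /hook_row; case: ifP => q4.
    by apply/Or32/column_line_tail; case: up; rewrite /xcol; lia.
  apply/Or31/column_line_vedge.
  + by case: ifP; [right | left].
  + by case: up; case: ifP => _; rewrite /yrow; lia.
  + by case: up; case: ifP => _; rewrite /yrow; lia.
- rewrite /hook_column /hook_row; case: ifP => q4.
    by apply/Or31/row_line_tail; case: up; rewrite /yrow; lia.
  apply/Or32/row_line_hedge.
  + by case: ifP; [left | right].
  + by case: up; case: ifP => _; rewrite /xcol; lia.
apply/Or33/frame_vedge.
by move: (hook_column i j q) (hook_row i j q) c60 r60 => c r; case: up; rewrite /yrow; lia.
Qed.

Lemma hook_line_share b t :
  share_edge (three_path (inl (hook_line b t))) (three_path (inr b)).
Proof.
case: b => [[[i j] q] up]; have [m0 m1 m2] := hook_share_lines i j q up.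
by case: t => [[|[|[|t]]] lt3]; [exact: m0 | exact: m1 | exact: m2 | case: (notF lt3)].
Qed.

(** A hook meets one line of each type and the frame, so two lines of the same type never occur
    together; [s] chooses the order of the pair. *)
Definition line_pair (p : bool * ('I_20 * 'I_20 + bool * 'I_20)) :=
  let: (s, c) := p in
  let: (a, a') := match c with
    | inl (i, j) => (Some (true, i), Some (false, j))
    | inr a => (Some a, None)
    end in if s then (a, a') else (a', a).

Definition line_pairs := line_pair @: [set: _].

Lemma card_line_pairs : #|line_pairs| <= 2 * (20 * 20 + 2 * 20).
Proof.
apply: leq_trans (leq_imset_card _ _) _.
by rewrite cardsT card_prod card_sum !card_prod card_bool !card_ord.
Qed.

Lemma hook_line_pairs b t t' : t != t' -> (hook_line b t, hook_line b t') \in line_pairs.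
Proof.
case: b => [[[i j] q] up].
case: t t' => [[|[|[|t]]] ?] [[|[|[|t']]] ?] // _; apply/imsetP.
- by exists (true, inl (i, j)).
- by exists (true, inr (true, i)).
- by exists (false, inl (i, j)).
- by exists (true, inr (false, j)).
- by exists (false, inr (true, i)).
- by exists (false, inr (false, j)).
Qed.

Lemma proper_subclass_3 : proper_subclass (Bm 3) (B 3).
Proof.
split; first exact: Bm_sub_B.
exists (intersection_graph three_path); split.
  by apply: intersection_graph_B; [apply: three_gpath | apply: three_bends].
move=> monotone; have := @monotonic_count _ _ 3 3 three_path hook_line line_pairs
  line_indep three_hook_indep hook_line_inj hook_line_share hook_line_pairs monotone.
(* There are 4000 hooks and 41 lines, so the count would give
   [16000 <= 12000 + 4 * (82 + 880) = 15848]. *)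
rewrite !card_prod card_option card_prod card_bool !card_ord.
by move: card_line_pairs; move: #|line_pairs| => n; lia.
Qed.

Theorem theorem3p8 (k : nat) (hk : k = 3 \/ k = 5 \/ 7 <= k) :
  proper_subclass (Bm k) (B k).
Proof.
case: hk => [->|hk]; first exact: proper_subclass_3.
by apply: proper_subclass_ge4; case: hk => [->|/(leq_trans _)->].
Qed.
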